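(* Let $d\ge1$ and let $\mu$ be a non-trivial probability nc measure on $\mathscr{A}_d$ with nc Christoffel approximates $(\Lambda_n(\cdot;\mu))_{n\in\mathbb{N}}$. The pointwise limit $$\lim_{n\to\infty}\Lambda_n(A;\mu)$$ exists for all $A\in(\mathbb{C}^{k\times k})^d$ and all $k\in\mathbb{N}$, $k\geq 1$, and is given by $$\lim_{n\to\infty}\Lambda_n(A;\mu)=\inf\big\{(\mu\otimes\mathrm{Id}_k)(Q^*Q)\;:\;Q\in(\mathbb{C}\langle Z\rangle)^{k\times k},\;Q(A)=I_k\big\},$$ where the infimum is the greatest lower bound with respect to the Loewner order on Hermitian $k\times k$ matrices.
   Context: $\mathbb{F}_d^+$ is the free monoid on the generators $1,\dots,d$, with identity $\emptyset$ and product given by concatenation; $|\sigma|$ is the length of $\sigma$. Shortlex ordering: $\sigma\prec\tau$ if $|\sigma|<|\tau|$, or if $|\sigma|=|\tau|$ and $\sigma$ precedes $\tau$ lexicographically (with $1\prec\cdots\prec d$). $\sigma(n)=d\cdots d$ ($n$ copies) is the last word of length $n$; $\sigma(0)=\emptyset$. For a $d$-tuple $Z$ and $\sigma=\sigma_1\cdots\sigma_n$, $Z^\sigma:=Z_{\sigma_1}\cdots Z_{\sigma_n}$, $Z^\emptyset:=1$ (the identity). $\mathbb{C}\langle Z\rangle$ is the algebra of polynomials in $d$ noncommuting variables $Z_1,\dots,Z_d$ with complex coefficients (nc polynomials). The nc Hardy space $\mathbb{H}^2_d$ is the Hilbert space of formal power series $\sum_{\sigma}c_\sigma Z^\sigma$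 with $\sum_\sigma|c_\sigma|^2<\infty$ and orthonormal basis $\{Z^\sigma\}$; $L=(L_1,\dots,L_d)$ is given by $(L_jf)(Z)=Z_jf(Z)$, so $L_j^*L_k=\delta_{jk}I$. $\mathcal{A}_d$ is the operator-norm closure of $\{p(L):p\in\mathbb{C}\langle Z\rangle\}$ and $\mathscr{A}_d:=\overline{\mathcal{A}_d+\mathcal{A}_d^*}$ (operator-norm closure). An nc measure is a linear functional $\mu:\mathscr{A}_d\to\mathbb{C}$ with $\mu(f)\ge0$ for all positive operators $f\in\mathscr{A}_d$. For nc polynomials $P,Q$, $\mu(Q^*P)$ means $\mu(Q(L)^*P(L))$. $\mu$ is a probability nc measure if $\mu(I)=1$; it is non-trivial if for $K_\mu(\sigma,\tau):=\mu((L^\tau)^*L^\sigma)$ the matrix $[K_\mu(\sigma,\tau)]_{\sigma,\tau\preceq\sigma_0}$ is invertible for every $\sigma_0\in\mathbb{F}_d^+$. In that case $\langle P,Q\rangle_\mu:=\mu(Q^*P)$ is an inner product on $\mathbb{C}\langle Z\rangle$, and the orthonormal polynomials $(\varphi_\sigma)_{\sigma\in\mathbb{F}_d^+}$ of $\mu$ are obtained by applying Gram–Schmidt (with normalisation, positive leading coefficients) to $\{Z^\sigma\}$ in the shortlex order with respect to $\langle\cdot,\cdot\rangle_\mu$. For $A\in(\mathbb{C}^{k\times k})^d$ the $n$-th nc Christoffel approximate is $$\Lambda_n(A;\mu):=\Big(\sum_{\emptyset\preceq\sigma\preceq\sigma(n)}\varphi_\sigma(A)\varphi_\sigma(A)^*\Big)^{-1}\in\mathbb{C}^{k\times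 k}.$$ Matrices of nc polynomials: $(\mathbb{C}\langle Z\rangle)^{k\times k}\cong\mathbb{C}\langle Z\rangle\otimes\mathbb{C}^{k\times k}$ with product $(p\otimes a)(q\otimes b)=pq\otimes ab$. For $Q=\sum_\tau Z^\tau\otimes c_\tau$ (finite sum, $c_\tau\in\mathbb{C}^{k\times k}$), the evaluation at $A\in(\mathbb{C}^{k\times k})^d$ is $Q(A):=\sum_\tau A^\tau c_\tau\in\mathbb{C}^{k\times k}$, and $(\mu\otimes\mathrm{Id}_k)(Q^*Q):=\sum_{\sigma,\tau}\mu\big((L^\sigma)^*L^\tau\big)\,c_\sigma^*c_\tau\in\mathbb{C}^{k\times k}$. *)

(* Defs.v *)
From HB Require Import structures.
From mathcomp Require Import all_boot all_order all_algebra.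
From mathcomp Require Import finmap complex ring lra.
From mathcomp Require Import all_classical all_reals all_analysis.
From mathcomp Require monalg.
(* The notations of monalg clash with those of MathComp-Analysis. *)
Export -(notations) monalg.

Set Implicit Arguments.
Unset Strict Implicit.
Unset Printing Implicit Defensive.

Import Order.TTheory GRing.Theory Num.Theory.
Import numFieldNormedType.Exports.

Local Open Scope classical_set_scope.
Local Open Scope ring_scope.
Local Open Scope sesquilinear_scope.

(* A constant (not a notation), so that the topology that MathComp-Analysis
   attaches to any numClosedFieldType is inferred on it. *)
Definition CC (R : realType) : numClosedFieldType := R[i].

Definition sqmod (R : realType) (z : CC R) : R :=
  (complex.Re z) ^+ 2 + (complex.Im z) ^+ 2.

Definition word (d : nat) := fmonom 'I_d.

(* [seqlexi 'I_d] is [seq 'I_d] with its lexicographic order. *)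
Definition shortlex_le d (s t : word d) : bool :=
  (size s < size t)%N
  || (size s == size t) && ((s : seqlexi 'I_d) <= (t : seqlexi 'I_d))%O.

Definition words_of_length d n : seq (word d) :=
  [seq FMonom (tval t) | t : n.-tuple 'I_d].

Definition words_of_length_le d n : seq (word d) :=
  flatten [seq words_of_length d m | m <- iota 0 n.+1].

(* The words that precede or equal [s], listed in increasing shortlex order. *)
Definition words_upto d (s : word d) : seq (word d) :=
  sort (@shortlex_le d)
    [seq w <- words_of_length_le d (size s) | shortlex_le w s].

(* sigma(n) = d...d, over an alphabet with d.+1 letters. *)
Definition last_word d n : word d.+1 := FMonom (nseq n ord_max).

Definition ncpoly (R : realType) d := malg (word d) (CC R).

Definition ncmonom (R : realType) d (w : word d) : ncpoly R d := mkmalgU w 1.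

(* Evaluation of [p] when [h w] is the value of the monomial Z^w. *)
Definition nceval (R : realType) d (V : lmodType (CC R)) (h : word d -> V)
    (p : ncpoly R d) : V :=
  \sum_(w <- msupp p) mcoeff w p *: h w.

Definition mxword (R : realType) d k (A : 'I_d -> 'M[CC R]_k) (w : word d) :
    'M[CC R]_k :=
  foldr (fun j M => A j *m M) 1%:M (fmonom_val w).

Section Hardy.
Context (R : realType) (d : nat).
Local Notation C := (CC R).

Definition sqsummable : {pred word d -> C} :=
  fun f => `[< (\esum_(w in [set: word d]) (sqmod (f w))%:E < +oo)%E >].

Lemma sqmod_ge0 (z : C) : 0 <= sqmod z.
Proof. by rewrite /sqmod addr_ge0// sqr_ge0. Qed.

Lemma sqmodD_le (a b : C) : sqmod (a + b) <= 2 * sqmod a + 2 * sqmod b.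
Proof.
case: a => a1 a2; case: b => b1 b2; rewrite /sqmod /= -subr_ge0.
suff -> : 2 * (a1 ^+ 2 + a2 ^+ 2) + 2 * (b1 ^+ 2 + b2 ^+ 2) -
    ((a1 + b1) ^+ 2 + (a2 + b2) ^+ 2) = (a1 - b1) ^+ 2 + (a2 - b2) ^+ 2.
  by rewrite addr_ge0// sqr_ge0.
by rewrite !sqrrD !sqrrN; lra.
Qed.

Lemma sqmodM (a b : C) : sqmod (a * b) = sqmod a * sqmod b.
Proof. by case: a => a1 a2; case: b => b1 b2; rewrite /sqmod /=; ring. Qed.

Lemma sqsummableP (f : word d -> C) :
  reflect (\esum_(w in [set: word d]) (sqmod (f w))%:E < +oo)%E
          (f \in sqsummable).
Proof. exact: asboolP. Qed.

Lemma esum_mulrn_lty (a : word d -> R) n : (forall w, 0 <= a w) ->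
  (\esum_(w in [set: word d]) (a w)%:E < +oo)%E ->
  (\esum_(w in [set: word d]) (a w *+ n)%:E < +oo)%E.
Proof.
move=> a0 afin; elim: n => [|n IHn].
  by rewrite esum1// => w _; rewrite mulr0n.
under eq_esum do rewrite mulrS EFinD.
by rewrite esumD ?lte_add_pinfty// => w _; rewrite lee_fin ?mulrn_wge0.
Qed.

Lemma esum_leMn_lty (a b : word d -> R) n : (forall w, 0 <= a w) ->
  (forall w, b w <= a w *+ n) ->
  (\esum_(w in [set: word d]) (a w)%:E < +oo)%E ->
  (\esum_(w in [set: word d]) (b w)%:E < +oo)%E.
Proof.
move=> a0 ba /(esum_mulrn_lty n a0); apply: le_lt_trans.
by apply: le_esum => w _; rewrite lee_fin.
Qed.

Lemma sqsummable_submod : submod_closed sqsummable.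
Proof.
split=> [|c f g /sqsummableP fS /sqsummableP gS]; apply/sqsummableP.
  by rewrite esum1// => w _; rewrite /sqmod /= expr0n addr0.
pose n := (Num.truncn (sqmod c)).+1.
apply: (@esum_leMn_lty (fun w => sqmod (f w) *+ n + sqmod (g w)) _ 2).
- by move=> w; rewrite addr_ge0 ?mulrn_wge0 ?sqmod_ge0.
- move=> w; rewrite (le_trans (sqmodD_le _ _))// -mulrDr mulr_natl.
  rewrite lerMn2r/= lerD2r sqmodM -mulr_natl ler_wpM2r ?sqmod_ge0//.
  exact/ltW/truncnS_gt.
under eq_esum do rewrite EFinD.
rewrite esumD ?lte_add_pinfty// => [|w _|w _].
- by apply: esum_mulrn_lty => // w; exact: sqmod_ge0.
- by rewrite lee_fin mulrn_wge0 ?sqmod_ge0.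
- by rewrite lee_fin sqmod_ge0.
Qed.

(* The coefficients of the power series Z_j f(Z). *)
Definition shift_coefs (j : 'I_d) (f : word d -> C) (w : word d) : C :=
  if fmonom_val w is i :: w' then if i == j then f (FMonom w') else 0 else 0.

Lemma shift_sqsummable (j : 'I_d) (f : word d -> C) :
  f \in sqsummable -> shift_coefs j f \in sqsummable.
Proof.
move=> /sqsummableP fS; apply/sqsummableP.
pose e (w : word d) : word d := FMonom (j :: fmonom_val w).
pose b (w : word d) : \bar R := (sqmod (shift_coefs j f w))%:E.
rewrite (_ : (\esum_(w in _) _)%E = (\esum_(w in e @` setT) b w)%E).
  rewrite esum_image => [|w1 w2 _ _ []]; last first.
    by case: w1 => s1; case: w2 => s2 /= ->.
  rewrite (_ : (\esum_(w in _) _)%E =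
      (\esum_(w in [set: word d]) (sqmod (f w))%:E)%E)//.
  by apply: eq_esum => -[s] _; rewrite /b /shift_coefs /= eqxx.
rewrite [RHS]esum_mkcond; apply: eq_esum => w _; case: ifPn => // wNe.
have -> : shift_coefs j f w = 0; last by rewrite /sqmod /= expr0n addr0.
case: w wNe => -[//|i s]; rewrite /shift_coefs /=.
case: eqVneq => // -> /negP[]; apply/mem_set.
by exists (FMonom s).
Qed.

HB.instance Definition _ := GRing.isSubmodClosed.Build C (word d -> C)
  sqsummable sqsummable_submod.

Record hardy := Hardy {coefs :> word d -> C; _ : coefs \in sqsummable}.

HB.instance Definition _ := [isSub for coefs].
HB.instance Definition _ := [Choice of hardy by <:].
HB.instance Definition _ := [SubChoice_isSubLmodule of hardy by <:].

(* The series converges absolutely, so summing by increasing length of words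
   is immaterial. *)
Definition hdot (f g : hardy) : C :=
  limn (fun n => \sum_(w <- words_of_length_le d n) f w * (g w)^*).

Definition hnorm (f : hardy) : R :=
  Num.sqrt (fine (\esum_(w in [set: word d]) (sqmod (f w))%:E)).

Definition operator := hardy -> hardy.

Definition opnorm_le (T : operator) (M : R) : Prop :=
  forall f, hnorm (T f) <= M * hnorm f.

Definition bounded_op (T : operator) : Prop :=
  linear T /\ exists M : R, opnorm_le T M.

(* The bounded operator [S] with <T f, g> = <f, S g>, which is unique; the default
   value 0 is irrelevant since every bounded operator has an adjoint. *)
Definition adjoint (T : operator) : operator :=
  xget 0 [set S : operator |
    bounded_op S /\ forall f g, hdot (T f) g = hdot f (S g)].

Definition positive_op (T : operator) : Prop := forall f, 0 <= hdot (T f) f.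

(* Closure in the operator norm: [opnorm_le (T - S) e] says ||T - S|| <= e. *)
Definition opclosure (X : set operator) : set operator :=
  [set T | bounded_op T /\
    forall e : R, 0 < e -> exists2 S, X S & opnorm_le (T - S) e].

Definition Lshift (j : 'I_d) : operator :=
  fun f => Hardy (shift_sqsummable j (valP f)).

Definition Lword (w : word d) : operator :=
  foldr (fun j T => Lshift j \o T) id (fmonom_val w).

Definition Lpoly (p : ncpoly R d) : operator := nceval Lword p.

Definition disk_algebra : set operator := opclosure (range Lpoly).

Definition disk_system : set operator :=
  opclosure [set S + adjoint T | S in disk_algebra & T in disk_algebra].

(* A functional on [disk_system] is represented by a function on all operators
   whose values outside of [disk_system] are irrelevant. *)
Definition nc_measure (mu : operator -> C) : Prop :=
  (forall (a : C) (S T : operator), disk_system S -> disk_system T ->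
     mu (a *: S + T) = a * mu S + mu T) /\
  (forall T : operator, disk_system T -> positive_op T -> 0 <= mu T).

Context (mu : operator -> C).

Definition probability_nc_measure : Prop := mu id = 1.

Definition nc_kernel (s t : word d) : C := mu (adjoint (Lword t) \o Lword s).

Definition nontrivial_nc_measure : Prop :=
  forall s0 : word d, let ws := words_upto s0 in
    \matrix_(i < size ws, j < size ws)
      nc_kernel (nth s0 ws i) (nth s0 ws j) \in unitmx.

Definition nc_inner (P Q : ncpoly R d) : C :=
  mu (adjoint (Lpoly Q) \o Lpoly P).

Context (k : nat).

(* The coefficient c_w in the decomposition Q = \sum_w Z^w (x) c_w. *)
Definition ncmx_coef (Q : 'M[ncpoly R d]_k) (w : word d) : 'M[C]_k :=
  map_mx (mcoeff w) Q.

Definition ncmx_supp (Q : 'M[ncpoly R d]_k) : {fset word d} :=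
  \big[fsetU/fset0]_(ij : 'I_k * 'I_k) msupp (Q ij.1 ij.2).

Definition ncmx_eval (A : 'I_d -> 'M[C]_k) (Q : 'M[ncpoly R d]_k) : 'M[C]_k :=
  \sum_(w <- ncmx_supp Q) mxword A w *m ncmx_coef Q w.

(* (mu (x) Id_k)(Q^* Q). *)
Definition ncmx_sqform (Q : 'M[ncpoly R d]_k) : 'M[C]_k :=
  \sum_(s <- ncmx_supp Q) \sum_(t <- ncmx_supp Q)
    mu (adjoint (Lword s) \o Lword t) *:
      ((ncmx_coef Q s)^t* *m ncmx_coef Q t).

End Hardy.

Section GramSchmidt.
Context (C : numClosedFieldType) (V : lmodType C) (ip : V -> V -> C).

Definition normalize (v : V) : V := (sqrtC (ip v v))^-1 *: v.

(* The accumulator [es] holds the vectors already orthonormalised; [ip] is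
   linear in its first argument. *)
Definition gram_schmidt (vs : seq V) : seq V :=
  foldl (fun es v => rcons es (normalize (v - \sum_(e <- es) ip v e *: e)))
    [::] vs.

End GramSchmidt.

Definition orthopoly (R : realType) d (mu : operator R d -> CC R) (s : word d) :
    ncpoly R d :=
  last 0 (gram_schmidt (nc_inner mu) [seq ncmonom R w | w <- words_upto s]).

Definition christoffel (R : realType) d (mu : operator R d.+1 -> CC R) k
    (n : nat) (A : 'I_d.+1 -> 'M[CC R]_k) : 'M[CC R]_k :=
  invmx (\sum_(s <- words_upto (last_word d n))
    let M := nceval (mxword A) (orthopoly mu s) in M *m M^t*).

Section Loewner.
Context (C : numClosedFieldType) (k : nat).

Definition psdmx (M : 'M[C]_k) : Prop :=
  M \is hermsymmx /\ forall v : 'rV[C]_k, 0 <= (v *m M *m v^t*) 0 0.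

Definition loewner_le (X Y : 'M[C]_k) : Prop := psdmx (Y - X).

(* [X] is the greatest lower bound of [S] among the Hermitian matrices. *)
Definition loewner_inf (S : set 'M[C]_k) (X : 'M[C]_k) : Prop :=
  [/\ X \is hermsymmx,
      forall Y, S Y -> loewner_le X Y &
      forall Z : 'M[C]_k, Z \is hermsymmx ->
        (forall Y, S Y -> loewner_le Z Y) -> loewner_le Z X].

End Loewner.

(* Main.v *)
(** Write a polynomial matrix of degree at most [n] in the orthonormal basis as
    [Q = \sum_s phi_s (x) a_s].  Then [Q(A) = \sum_s phi_s(A) a_s] and
    [(mu (x) Id)(Q^* Q) = \sum_s a_s^* a_s].  With
    [G = \sum_s phi_s(A) phi_s(A)^*], completing the square shows that, subject
    to [Q(A) = I], the second expression has the least value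
    [G^-1 = Lambda_n(A)], attained at [a_s = phi_s(A)^* G^-1].  So
    [Lambda_n(A)] is a decreasing sequence of positive matrices; it converges by
    polarization, and its limit inherits both halves of the infimum property.
    That [mu(Q^* P)] is a sesquilinear positive form rests on
    [(L^s)^* L^t] being a word in the [L_j], the adjoint of such a word, or 0. *)
Require Import Defs.
From mathcomp Require Import all_boot all_order all_algebra.
From mathcomp Require Import finmap complex ring lra.
From mathcomp Require Import all_classical all_reals all_analysis.
Import numFieldNormedType.Exports.
Import Order.TTheory GRing.Theory Num.Theory.

Set Implicit Arguments.
Unset Strict Implicit.
Unset Printing Implicit Defensive.

Local Open Scope classical_set_scope.
Local Open Scope ring_scope.
Local Open Scope sesquilinear_scope.

(** [mu] is a bare function on operators, constrained only on [disk_system], and [adjoint] is a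
    choice with a default value, so neither can be computed with directly. The adjoint of each word
    is therefore exhibited as a word in backward shifts and identified by uniqueness of adjoints,
    and every operator to which linearity or positivity of [mu] is applied is first brought to the
    form P(L) + Q(L)^*. Hermitian symmetry of mu(Q^* P) is not part of the definition of
    [nc_measure]; it is extracted from positivity on complex combinations. Positivity alone gives a
    semidefinite form. Definiteness comes from the invertible kernel matrices, because a null
    polynomial is orthogonal to every monomial; it keeps Gram-Schmidt from dividing by 0. The side
    of each factor matters: evaluation puts A^w to the left of the coefficient c_w, while the form
    pairs c_s^* with c_t. This is what makes phi_s(A) phi_s(A)^* the relevant Gram terms. Since
    sigma(n) is the last word of its length, truncation at sigma(n) is truncation by degree, so each
    competitor Q is admissible for all large n. *)

(** * Limits of complex sequences through real and imaginary parts *)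

Section ComplexLimits.
Context (R : realType).
Local Notation C := (CC R).

Lemma CC_normE (z : C) : `|z| = Complex (Num.sqrt (sqmod z)) 0.
Proof. exact: normc_def. Qed.

(** The order of [CC R] only compares numbers with equal imaginary parts, so a positive tolerance of
    the complex topology is a positive real one. *)
Lemma CC_gt0 (e : C) : 0 < e -> exists2 r : R, 0 < r & e = Complex r 0.
Proof. by case: e => a b; rewrite ltcE /= => /andP[/eqP -> r0]; exists a. Qed.

Lemma CC_ge0E (z : C) : (0 <= z) = (complex.Im z == 0) && (0 <= complex.Re z).
Proof. by rewrite lecE. Qed.

Lemma conj_CCE (z : C) : z^* = Complex (complex.Re z) (- complex.Im z).
Proof. by case: z. Qed.

Lemma sqr_add_lt (x y r : R) : 0 < r -> `|x| <= r / 2 -> `|y| <= r / 2 ->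
  x ^+ 2 + y ^+ 2 < r ^+ 2.
Proof.
move=> r0 hx hy; have sq_le z : `|z| <= r / 2 -> z ^+ 2 <= (r / 2) ^+ 2.
  move=> hz; rewrite -(real_normK (num_real z)).
  by apply: lerXn2r => //; rewrite nnegrE ?(le_trans _ hz).
apply: le_lt_trans (lerD (sq_le _ hx) (sq_le _ hy)) _.
have -> : (r / 2) ^+ 2 + (r / 2) ^+ 2 = r ^+ 2 / 2 by field.
have : 0 < r ^+ 2 by rewrite exprn_gt0.
by lra.
Qed.

Lemma cvg_complex (u : nat -> C) (l : C) :
  (fun n => complex.Re (u n)) @ \oo --> complex.Re l ->
  (fun n => complex.Im (u n)) @ \oo --> complex.Im l ->
  u @ \oo --> l.
Proof.
move=> /cvgrPdist_le uRe /cvgrPdist_le uIm; apply/cvgrPdist_lt => e.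
move=> /CC_gt0[r r0 ->].
have r20 : 0 < r / 2 by rewrite divr_gt0.
near=> n; rewrite CC_normE ltcE /= eqxx /=.
have Hr : `|complex.Re l - complex.Re (u n)| <= r / 2 by near: n; exact: uRe.
have Hi : `|complex.Im l - complex.Im (u n)| <= r / 2 by near: n; exact: uIm.
suff s : sqmod (l - u n) < r ^+ 2.
  by rewrite -[ltRHS](gtr0_norm r0) -sqrtr_sqr ltr_sqrt ?exprn_gt0.
rewrite /sqmod.
have -> : complex.Re (l - u n) = complex.Re l - complex.Re (u n).
  by case: (l) (u n) => [? ?] [].
have -> : complex.Im (l - u n) = complex.Im l - complex.Im (u n).
  by case: (l) (u n) => [? ?] [].
exact: sqr_add_lt.
Unshelve. all: by end_near.
Qed.

Lemma cvg_Re (u : nat -> C) (l : C) :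
  u @ \oo --> l -> (fun n => complex.Re (u n)) @ \oo --> complex.Re l.
Proof.
move=> /cvgrPdist_le ul; apply/cvgrPdist_le => e e0.
near=> n; have : `|l - u n| <= Complex e 0.
  by near: n; apply: ul; rewrite ltcE /= eqxx.
rewrite CC_normE lecE /= eqxx /=; apply: le_trans.
rewrite -sqrtr_sqr ler_wsqrtr// /sqmod.
have -> : complex.Re (l - u n) = complex.Re l - complex.Re (u n).
  by case: (l) (u n) => [? ?] [].
by rewrite lerDl sqr_ge0.
Unshelve. all: by end_near.
Qed.

Lemma cvg_Im (u : nat -> C) (l : C) :
  u @ \oo --> l -> (fun n => complex.Im (u n)) @ \oo --> complex.Im l.
Proof.
move=> /cvgrPdist_le ul; apply/cvgrPdist_le => e e0.
near=> n; have : `|l - u n| <= Complex e 0.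
  by near: n; apply: ul; rewrite ltcE /= eqxx.
rewrite CC_normE lecE /= eqxx /=; apply: le_trans.
rewrite -sqrtr_sqr ler_wsqrtr// /sqmod.
have -> : complex.Im (l - u n) = complex.Im l - complex.Im (u n).
  by case: (l) (u n) => [? ?] [].
by rewrite lerDr sqr_ge0.
Unshelve. all: by end_near.
Qed.

Lemma Re_conj (z : C) : complex.Re z^* = complex.Re z.
Proof. by rewrite conj_CCE. Qed.

Lemma Im_conj (z : C) : complex.Im z^* = - complex.Im z.
Proof. by rewrite conj_CCE. Qed.

Lemma cvg_conj (u : nat -> C) (l : C) :
  u @ \oo --> l -> (fun n => (u n)^*) @ \oo --> l^*.
Proof.
move=> ul; apply: cvg_complex.
  by rewrite Re_conj; under eq_fun do rewrite Re_conj; exact: cvg_Re.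
rewrite Im_conj; under eq_fun do rewrite Im_conj.
by apply: cvgN; exact: cvg_Im.
Qed.

(** Nonnegativity in C joins a sign on the real part to a vanishing imaginary part; each of the two
    passes to the limit on its own. *)
Lemma cvg_CC_ge0 (u : nat -> C) (l : C) :
  u @ \oo --> l -> (forall n, 0 <= u n) -> 0 <= l.
Proof.
move=> ul u0; rewrite CC_ge0E; apply/andP; split.
  have := cvg_lim (@Rhausdorff R) (cvg_Im ul).
  rewrite (_ : (fun n => _) = fun=> 0); first by rewrite lim_cst// => ->.
  by apply/funext => n; have := u0 n; rewrite CC_ge0E => /andP[/eqP].
have h := cvg_Re ul; rewrite -(cvg_lim (@Rhausdorff R) h).
apply: limr_ge; first by apply/cvg_ex; exists (complex.Re l).
by near=> n; have := u0 n; rewrite CC_ge0E => /andP[].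
Unshelve. all: by end_near.
Qed.

(** The imaginary parts are constantly 0, so this is monotone convergence of the real parts. *)
Lemma nonincreasing_CC_cvg (u : nat -> C) :
  (forall n, 0 <= u n) -> (forall n, u n.+1 <= u n) -> cvgn u.
Proof.
move=> u0 udec.
have cv : cvgn (fun n => complex.Re (u n)).
  apply: nonincreasing_is_cvgn.
    apply/nonincreasing_seqP => n.
    by have := udec n; rewrite lecE => /andP[].
  by exists 0 => _ [n _ <-]; have := u0 n; rewrite CC_ge0E => /andP[].
apply/cvg_ex; exists (Complex (limn (fun n => complex.Re (u n))) 0).
apply: cvg_complex => //=.
rewrite (_ : (fun n => _) = fun=> 0); first exact: cvg_cst.
by apply/funext => n; have := u0 n; rewrite CC_ge0E => /andP[/eqP].
Qed.

End ComplexLimits.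

(** * Words of bounded length *)

Section Words.
Context (d : nat).
Local Notation word := (word d).
Local Notation ball_words := (words_of_length_le d).

Lemma mem_words_of_length n (w : word) :
  (w \in words_of_length d n) = (size w == n).
Proof.
apply/fintype.imageP/eqP => [[t _ ->]|wn]; first by rewrite size_tuple.
by exists (tcast wn (in_tuple w)) => //; rewrite val_tcast; case: w {wn}.
Qed.

Lemma words_of_length_uniq n : uniq (words_of_length d n).
Proof.
by rewrite map_inj_uniq ?enum_uniq// => s t [] /val_inj.
Qed.

Lemma mem_words_of_length_le n (w : word) : (w \in ball_words n) = (size w <= n)%N.
Proof.
apply/flatten_mapP/idP => [[m]|wn].
  by rewrite mem_iota mem_words_of_length => mn /eqP ->.
by exists (size w); rewrite ?mem_iota ?mem_words_of_length.
Qed.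

Lemma words_of_length_leS n :
  ball_words n.+1 = ball_words n ++ words_of_length d n.+1.
Proof.
by rewrite /words_of_length_le -[n.+2]addn1 iotaD map_cat flatten_cat /= cats0 add0n.
Qed.

Lemma words_of_length_le_uniq n : uniq (ball_words n).
Proof.
elim: n => [|n IHn]; first by rewrite /words_of_length_le /= cats0 words_of_length_uniq.
rewrite words_of_length_leS cat_uniq IHn words_of_length_uniq andbT /=.
apply/hasPn => w; rewrite mem_words_of_length mem_words_of_length_le => /eqP ->.
by rewrite ltnn.
Qed.

Definition consw (j : 'I_d) (w : word) : word := FMonom (j :: fmonom_val w).

Lemma consw_inj j : injective (consw j).
Proof. by move=> [s] [t] [->]. Qed.

(** Prefixing a letter raises the length by one, hence the radius [n.+1]. This change of index
    relates the partial sums of a series to those of its shift. *)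
Lemma perm_words_consw j n :
  perm_eq [seq w <- ball_words n.+1 | if fmonom_val w is i :: _ then i == j else false]
          [seq consw j w | w <- ball_words n].
Proof.
apply: uniq_perm.
- by apply: filter_uniq; exact: words_of_length_le_uniq.
- by rewrite map_inj_uniq ?words_of_length_le_uniq//; exact: consw_inj.
move=> w; rewrite mem_filter mem_words_of_length_le.
apply/andP/mapP => [[]|[v]].
  case: w => -[//|i s] /= /eqP -> sn.
  by exists (FMonom s) => //; rewrite mem_words_of_length_le.
by rewrite mem_words_of_length_le => vn -> /=; rewrite eqxx.
Qed.

End Words.

Lemma sum_uniq_sub (I : eqType) (K : numDomainType) (r s : seq I) (F : I -> K) :
  uniq r -> uniq s -> {subset r <= s} -> (forall i, 0 <= F i) ->
  \sum_(i <- r) F i <= \sum_(i <- s) F i.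
Proof.
move=> ur us rs F0.
have pr : perm_eq r [seq i <- s | i \in r].
  apply: uniq_perm; rewrite ?filter_uniq// => i; rewrite mem_filter.
  by case: (boolP (i \in r)) => // /rs ->.
rewrite (perm_big _ pr)/= big_filter [leRHS](bigID (mem r))/=.
by rewrite lerDl sumr_ge0.
Qed.

(** * Summation over all words as a limit over balls of words *)

Section PartialSums.
Context (R : realType) (d : nat).
Local Notation word := (word d).
Local Notation ball_words := (words_of_length_le d).
Local Notation C := (CC R).

Lemma sum_consw (V : nmodType) (F : word -> V) (j : 'I_d) n :
  \sum_(w <- ball_words n.+1 |
      if fmonom_val w is i :: _ then i == j else false) F w =
  \sum_(w <- ball_words n) F (consw j w).
Proof. by rewrite -big_filter (perm_big _ (perm_words_consw j n)) big_map. Qed.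

Lemma esum_words_le (a : word -> R) (c : R) : (forall w, 0 <= a w) ->
  (forall n, \sum_(w <- ball_words n) a w <= c) ->
  (\esum_(w in [set: word]) (a w)%:E <= c%:E)%E.
Proof.
move=> a0 ac; apply: ub_ereal_sup => _ [A [finA _] <-].
rewrite fsbig_finite//= sumEFin lee_fin.
pose r : seq word := fset_set A.
(* The balls exhaust the words: a finite set lies in the ball whose radius is the length of its
   longest element. *)
apply: le_trans (ac (\max_(w <- r) size w)); apply: sum_uniq_sub => //.
- exact: fset_uniq.
- exact: words_of_length_le_uniq.
- move=> w wA; rewrite mem_words_of_length_le.
  exact: (@leq_bigmax_seq _ r xpredT (fun v : word => size v) w).
Qed.

Lemma partial_sum_le (a : word -> R) n : (forall w, 0 <= a w) ->
  (\esum_(w in [set: word]) (a w)%:E < +oo)%E ->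
  \sum_(w <- ball_words n) a w <= fine (\esum_(w in [set: word]) (a w)%:E)%E.
Proof.
move=> a0 afin; rewrite -lee_fin fineK.
  apply: esum_ge; exists [set` ball_words n]; first by split=> //; exact: finite_seq.
  by rewrite -fsbig_seq ?words_of_length_le_uniq// sumEFin.
by rewrite ge0_fin_numE// esum_ge0// => w _; rewrite lee_fin.
Qed.

Lemma partial_sum_homo (a : word -> R) : (forall w, 0 <= a w) ->
  {homo (fun n => \sum_(w <- ball_words n) a w) : n m / (n <= m)%N >-> n <= m}.
Proof.
move=> a0 n m nm; apply: sum_uniq_sub; rewrite ?words_of_length_le_uniq// => w.
by rewrite !mem_words_of_length_le => /leq_trans; apply.
Qed.

Lemma partial_sum_cvg (a : word -> R) : (forall w, 0 <= a w) ->
  (\esum_(w in [set: word]) (a w)%:E < +oo)%E ->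
  cvgn (fun n => \sum_(w <- ball_words n) a w).
Proof.
move=> a0 afin; apply: nondecreasing_is_cvgn; first exact: partial_sum_homo.
by eexists => _ [n _ <-]; exact: partial_sum_le.
Qed.

Lemma partial_sum_dominated_cvg (a h : word -> R) :
  (forall w, `|h w| <= a w) ->
  (\esum_(w in [set: word]) (a w)%:E < +oo)%E ->
  cvgn (fun n => \sum_(w <- ball_words n) h w).
Proof.
move=> ha afin.
have a0 w : 0 <= a w by exact: le_trans (ha w).
have ha0 w : 0 <= h w + a w.
  by have := ha w; rewrite ler_norml => /andP[? _]; rewrite -lerBlDr sub0r.
(* The partial sums of [h] need not be monotone; those of [h + a] and of [a] are, and both families
   are summable because [h + a] is at most twice [a]. *)
have -> : (fun n => \sum_(w <- ball_words n) h w) =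
  (fun n => \sum_(w <- ball_words n) (h w + a w)) -
  (fun n => \sum_(w <- ball_words n) a w).
  apply/funext => n; rewrite !fctE -sumrB.
  by under [RHS]eq_bigr do rewrite addrK.
apply: is_cvgB; apply: partial_sum_cvg => //.
apply: (@esum_leMn_lty _ _ a _ 2) => // w.
by rewrite mulr2n lerD2r (le_trans (ler_norm _)).
Qed.

End PartialSums.

(** * Inner product, adjoints and shifts on the Hardy space *)

Section HardySpace.
Context (R : realType) (d : nat).
Local Notation word := (word d).
Local Notation ball_words := (words_of_length_le d).
Local Notation C := (CC R).
Local Notation hardy := (hardy R d).
Local Notation operator := (operator R d).

Lemma hardyP (f g : hardy) : f =1 g -> f = g.
Proof. by move=> fg; apply: val_inj; apply/funext. Qed.

Lemma hardyDE (f g : hardy) w : (f + g) w = f w + g w.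
Proof. by []. Qed.

Lemma hardyZE (c : C) (f : hardy) w : (c *: f) w = c * f w.
Proof. by []. Qed.

Definition hnormsq (f : hardy) : R :=
  fine (\esum_(w in [set: word]) (sqmod (f w))%:E).

Lemma hardy_esum_lty (f : hardy) :
  (\esum_(w in [set: word]) (sqmod (f w))%:E < +oo)%E.
Proof. by apply/sqsummableP; exact: (valP f). Qed.

Lemma hnormsq_ge0 (f : hardy) : 0 <= hnormsq f.
Proof. by apply: fine_ge0; apply: esum_ge0 => w _; rewrite lee_fin sqmod_ge0. Qed.

Lemma partial_sum_le_hnormsq (f : hardy) n :
  \sum_(w <- ball_words n) sqmod (f w) <= hnormsq f.
Proof. by apply: partial_sum_le => [w|]; rewrite ?sqmod_ge0 ?hardy_esum_lty. Qed.

Lemma hnormsq_le (f : hardy) (c : R) :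
  (forall n, \sum_(w <- ball_words n) sqmod (f w) <= c) -> hnormsq f <= c.
Proof.
move=> fc; rewrite -lee_fin fineK; last first.
  by rewrite ge0_fin_numE ?hardy_esum_lty// esum_ge0// => w _; rewrite lee_fin sqmod_ge0.
by apply: esum_words_le => // w; exact: sqmod_ge0.
Qed.

(** The factors 2 come from |a + b|^2 <= 2|a|^2 + 2|b|^2 on each coefficient. Such a crude constant
    is enough, as only the existence of an operator bound matters. *)
Lemma hnormsq_ZD (c : C) (f g : hardy) :
  hnormsq (c *: f + g) <= 2 * (sqmod c * hnormsq f) + 2 * hnormsq g.
Proof.
apply: hnormsq_le => n.
apply: (@le_trans _ _ (\sum_(w <- ball_words n)
    (2 * (sqmod c * sqmod (f w)) + 2 * sqmod (g w)))).
  by apply: ler_sum => w _; rewrite -sqmodM; exact: sqmodD_le.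
rewrite big_split /= -!mulr_sumr.
by rewrite lerD// ler_wpM2l// ?ler_wpM2l ?sqmod_ge0 ?partial_sum_le_hnormsq.
Qed.

(** Boundedness in terms of squared norms: it is stable under sums without a triangle inequality for
    [hnorm], and the square root is taken once, in [sqbounded_bounded]. *)
Definition sqbounded (T : operator) : Prop :=
  exists2 M : R, 0 <= M & forall f, hnormsq (T f) <= M * hnormsq f.

Lemma sqbounded_bounded (T : operator) : linear T -> sqbounded T -> bounded_op T.
Proof.
move=> lT [M M0 TM]; split=> //; exists (Num.sqrt M) => f.
by rewrite /hnorm -sqrtrM// ler_wsqrtr//; exact: TM.
Qed.

Lemma sqbounded_id : sqbounded id.
Proof. by exists 1 => // f; rewrite mul1r. Qed.

Lemma sqbounded_comp (S T : operator) :
  sqbounded S -> sqbounded T -> sqbounded (S \o T).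
Proof.
move=> [M M0 SM] [N N0 TN]; exists (M * N) => [|f]; first exact: mulr_ge0.
by apply: le_trans (SM _) _; rewrite -mulrA ler_wpM2l.
Qed.

Lemma hnormsq0 : hnormsq 0 = 0.
Proof.
apply/eqP; rewrite eq_le hnormsq_ge0 andbT; apply: hnormsq_le => n.
by rewrite big1// => w _; rewrite /sqmod /= expr0n addr0.
Qed.

Lemma hnorm0 : hnorm (0 : hardy) = 0.
Proof. by rewrite /hnorm -/(hnormsq _) hnormsq0 sqrtr0. Qed.

Lemma sqbounded0 : sqbounded 0.
Proof. by exists 0 => // f; rewrite hnormsq0 mul0r. Qed.

Lemma sqbounded_ZD (c : C) (S T : operator) :
  sqbounded S -> sqbounded T -> sqbounded (c *: S + T).
Proof.
move=> [M M0 SM] [N N0 TN]; exists (2 * (sqmod c * M) + 2 * N) => [|f].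
  by rewrite addr_ge0 ?mulr_ge0 ?sqmod_ge0.
apply: le_trans (hnormsq_ZD _ _ _) _; rewrite [leRHS]mulrDl -!mulrA.
by rewrite lerD// ler_wpM2l// ler_wpM2l ?sqmod_ge0.
Qed.

Lemma Re_mulconj (a b : C) : complex.Re (a * b^*) =
  complex.Re a * complex.Re b + complex.Im a * complex.Im b.
Proof. by rewrite conj_CCE; case: a b => [a1 a2] [b1 b2] /=; ring. Qed.

Lemma Im_mulconj (a b : C) : complex.Im (a * b^*) =
  complex.Im a * complex.Re b - complex.Re a * complex.Im b.
Proof. by rewrite conj_CCE; case: a b => [a1 a2] [b1 b2] /=; ring. Qed.

(** Expanding the squares of x + y, x - y, z + t, z - t bounds both signs. Applied to the real and
    imaginary parts of [f w * (g w)^*], it dominates them by the summable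
    [sqmod (f w) + sqmod (g w)]. *)
Lemma normr_mulD_le (x y z t : R) :
  `|x * y + z * t| <= (x ^+ 2 + z ^+ 2) + (y ^+ 2 + t ^+ 2).
Proof.
have h1 : 0 <= (x + y) ^+ 2 by exact: sqr_ge0.
have h2 : 0 <= (x - y) ^+ 2 by exact: sqr_ge0.
have h3 : 0 <= (z + t) ^+ 2 by exact: sqr_ge0.
have h4 : 0 <= (z - t) ^+ 2 by exact: sqr_ge0.
have hx : 0 <= x ^+ 2 by exact: sqr_ge0.
have hy : 0 <= y ^+ 2 by exact: sqr_ge0.
have hz : 0 <= z ^+ 2 by exact: sqr_ge0.
have ht : 0 <= t ^+ 2 by exact: sqr_ge0.
move: h1 h2 h3 h4; rewrite !sqrrD !sqrrN !mulrN => h1 h2 h3 h4.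
by rewrite ler_norml; apply/andP; split; lra.
Qed.

Definition dot_sum (f g : hardy) n : C := \sum_(w <- ball_words n) f w * (g w)^*.

Lemma Re_sum (I : Type) (r : seq I) (F : I -> C) :
  complex.Re (\sum_(i <- r) F i) = \sum_(i <- r) complex.Re (F i).
Proof. by apply: (big_morph (fun z : C => complex.Re z)) => // -[? ?] []. Qed.

Lemma Im_sum (I : Type) (r : seq I) (F : I -> C) :
  complex.Im (\sum_(i <- r) F i) = \sum_(i <- r) complex.Im (F i).
Proof. by apply: (big_morph (fun z : C => complex.Im z)) => // -[? ?] []. Qed.

(** [hdot] is a bare [limn], so its algebraic laws become available only once the partial sums are
    known to converge. *)
Lemma dot_sum_cvg (f g : hardy) : dot_sum f g @ \oo --> hdot f g.
Proof.
have sumfg : (\esum_(w in [set: word]) (sqmod (f w) + sqmod (g w))%:E < +oo)%E.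
  under eq_esum do rewrite EFinD.
  by rewrite esumD ?lte_add_pinfty ?hardy_esum_lty// => w _; rewrite lee_fin sqmod_ge0.
suff : cvgn (dot_sum f g) by [].
have cRe : cvgn (fun n => \sum_(w <- ball_words n) complex.Re (f w * (g w)^*)).
  apply: partial_sum_dominated_cvg sumfg => w.
  by rewrite Re_mulconj; exact: normr_mulD_le.
have cIm : cvgn (fun n => \sum_(w <- ball_words n) complex.Im (f w * (g w)^*)).
  apply: partial_sum_dominated_cvg sumfg => w; rewrite Im_mulconj.
  rewrite -mulrN; apply: le_trans (normr_mulD_le _ _ _ _) _.
  by rewrite /sqmod sqrrN (addrC (_ (f w) ^+ 2)).
apply/cvg_ex; eexists (Complex (lim _) (lim _)); apply: cvg_complex => /=.
  by under eq_fun do rewrite Re_sum; exact: cRe.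
by under eq_fun do rewrite Im_sum; exact: cIm.
Qed.

Lemma hdotE (f g : hardy) (l : C) : dot_sum f g @ \oo --> l -> hdot f g = l.
Proof. by move=> /(cvg_lim (@norm_hausdorff _ _)). Qed.

Lemma hdot_linear (c : C) (f g h : hardy) :
  hdot (c *: f + g) h = c * hdot f h + hdot g h.
Proof.
apply: hdotE; rewrite (_ : dot_sum _ _ = fun n => c * dot_sum f h n + dot_sum g h n).
  by apply: cvgD; [apply: cvgM; [exact: cvg_cst|]|]; exact: dot_sum_cvg.
apply/funext => n; rewrite /dot_sum mulr_sumr -big_split /=.
by apply: eq_bigr => w _; rewrite mulrA -mulrDl.
Qed.

Lemma hdotC (f g : hardy) : hdot g f = (hdot f g)^*.
Proof.
apply: hdotE; rewrite (_ : dot_sum _ _ = fun n => (dot_sum f g n)^*).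
  by apply: cvg_conj; exact: dot_sum_cvg.
apply/funext => n; rewrite /dot_sum rmorph_sum.
by apply: eq_bigr => w _; rewrite rmorphM /= conjCK mulrC.
Qed.

Lemma hdot_ge0 (f : hardy) : 0 <= hdot f f.
Proof.
apply: (cvg_CC_ge0 (@dot_sum_cvg f f)) => n.
by apply: sumr_ge0 => w _; exact: mul_conjC_ge0.
Qed.

Definition delta_coefs (w v : word) : C := (v == w)%:R.

Lemma delta_sqsummable w : delta_coefs w \in sqsummable (R := R) (d := d).
Proof.
apply/sqsummableP.
apply: (@le_lt_trans _ _ (1%:E)); last exact: ltry.
apply: esum_words_le => [v|n]; first exact: sqmod_ge0.
apply: (@le_trans _ _ (\sum_(v <- ball_words n | v == w) 1)).
  rewrite [leRHS]big_mkcond /=; apply: ler_sum => v _.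
  by rewrite /delta_coefs /sqmod; case: eqP => _ /=; rewrite ?expr1n expr0n addr0.
rewrite -big_filter big_const_seq iter_addr_0 count_predT size_filter.
rewrite (count_uniq_mem w (words_of_length_le_uniq d n)).
by case: (_ \in _); rewrite ?mulr1n ?mulr0n ?ler01.
Qed.

Definition hdelta w : hardy := Hardy (delta_sqsummable w).

Lemma hdot_delta w (g : hardy) : hdot (hdelta w) g = (g w)^*.
Proof.
apply: hdotE; apply: cvg_near_cst; exists (size w) => // n /= wn.
rewrite /dot_sum (bigD1_seq w) ?words_of_length_le_uniq ?mem_words_of_length_le//=.
rewrite /delta_coefs eqxx mul1r big1 ?addr0// => v /negPf vw.
by rewrite /= /delta_coefs vw mul0r.
Qed.

Lemma adjointE (T S : operator) : bounded_op S ->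
  (forall f g, hdot (T f) g = hdot f (S g)) -> adjoint T = S.
Proof.
move=> bS TS; apply: xget_unique => // S' [_ TS'].
(* Pairing with the basis vector of [w] returns the conjugate of the coefficient at [w], so the
   adjunction identity determines every coefficient of [S g]. *)
apply/funext => g; apply: hardyP => w; apply: (inv_inj (@conjCK _)).
by rewrite -!hdot_delta -TS -TS'.
Qed.

Lemma hdot0l (g : hardy) : hdot 0 g = 0.
Proof. by have := hdot_linear (-1) 0 0 g; rewrite scaler0 addr0 mulN1r addNr. Qed.

(** Coefficients of L_j^* f: the terms of f that begin with Z_j are kept and lose that letter. *)
Definition backshift_coefs (j : 'I_d) (f : word -> C) (w : word) : C := f (consw j w).

Lemma backshift_sum_le (j : 'I_d) (f : hardy) n :
  \sum_(w <- ball_words n) sqmod (backshift_coefs j f w) <= hnormsq f.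
Proof.
apply: le_trans (partial_sum_le_hnormsq f n.+1).
rewrite -(sum_consw (fun w => sqmod (f w))) big_mkcond; apply: ler_sum => w _.
case: ifP => // _; exact: sqmod_ge0.
Qed.

Lemma backshift_sqsummable (j : 'I_d) (f : hardy) :
  backshift_coefs j f \in sqsummable (R := R) (d := d).
Proof.
apply/sqsummableP; apply: (@le_lt_trans _ _ (hnormsq f)%:E); last exact: ltry.
by apply: esum_words_le => [w|n]; [exact: sqmod_ge0|exact: backshift_sum_le].
Qed.

Definition backshift (j : 'I_d) : operator :=
  fun f => Hardy (backshift_sqsummable j f).

Lemma backshift_linear j : linear (backshift j).
Proof. by move=> c f g; apply: hardyP. Qed.

Lemma sqbounded_backshift j : sqbounded (backshift j).
Proof.
exists 1 => // f; rewrite mul1r; apply: hnormsq_le => n.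
exact: backshift_sum_le.
Qed.

Lemma shift_consw j (f : hardy) i w :
  Lshift j f (consw i w) = if i == j then f w else 0.
Proof. by case: w. Qed.

Lemma Lshift_linear j : linear (@Lshift R d j).
Proof.
move=> c f g; apply: hardyP => -[[|i w]]; rewrite !(hardyDE, hardyZE) /=.
  by rewrite /shift_coefs /= mulr0 addr0.
by rewrite /shift_coefs /=; case: eqP => // _; rewrite mulr0 addr0.
Qed.

(** Shifted coefficients vanish off the words that begin with [j]. A general [F] lets the same
    identity serve both the norm bound and the inner product. *)
Lemma sum_Lshift (V : nmodType) (F : C -> word -> V) j (f : hardy) n :
  (forall w, F 0 w = 0) ->
  \sum_(w <- ball_words n.+1) F (Lshift j f w) w =
  \sum_(w <- ball_words n) F (f w) (consw j w).
Proof.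
move=> F0; rewrite (bigID (fun w : word =>
  if fmonom_val w is i :: _ then i == j else false)) /=.
rewrite [X in _ + X]big1 ?addr0 => [|[[|i s]] /= /negPf ij].
- rewrite (sum_consw (fun w => F (shift_coefs j f w) w)).
  by apply: eq_bigr => -[s] _; rewrite /shift_coefs /= eqxx.
- by rewrite /shift_coefs /= F0.
- by rewrite /shift_coefs /= ij F0.
Qed.

Lemma sqbounded_Lshift j : sqbounded (@Lshift R d j).
Proof.
exists 1 => // f; rewrite mul1r; apply: hnormsq_le => n.
apply: (@le_trans _ _ (\sum_(w <- ball_words n.+1) sqmod (Lshift j f w))).
  by apply: partial_sum_homo => // w; exact: sqmod_ge0.
rewrite (@sum_Lshift _ (fun z _ => sqmod z)) ?partial_sum_le_hnormsq// => w.
by rewrite /sqmod /= expr0n addr0.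
Qed.

Lemma Lshift_backshift j (f g : hardy) : hdot (Lshift j f) g = hdot f (backshift j g).
Proof.
(* The partial sum of radius n + 1 on the left equals the one of radius n on the right, so the left
   sequence is advanced by one. *)
apply: hdotE; rewrite -cvg_shiftS /=.
rewrite [X in X @ _](_ : _ = dot_sum f (backshift j g)); first exact: dot_sum_cvg.
apply/funext => n; rewrite /dot_sum.
by rewrite (@sum_Lshift _ (fun z w => z * (g w)^*))// => w; rewrite mul0r.
Qed.

Lemma backshift_Lshift i j :
  backshift i \o @Lshift R d j = if i == j then id else 0.
Proof.
apply/funext => f /=; apply: hardyP => w; rewrite [LHS]shift_consw.
by case: eqP.
Qed.

End HardySpace.

(** * Sums over the support of a polynomial *)

Section FiniteSupport.
Context (R : realType) (d : nat).
Local Notation C := (CC R).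

(** Sums over different supports can be added once both run over a common list. Asking only that [F]
    vanish at coefficient 0 covers linear and conjugate-linear summands alike. *)
Lemma sum_msupp_sub (V : nmodType) (P : ncpoly R d) (D : seq (word d))
    (F : C -> word d -> V) :
  uniq D -> {subset msupp P <= D} -> (forall w, F 0 w = 0) ->
  \sum_(w <- msupp P) F (mcoeff w P) w = \sum_(w <- D) F (mcoeff w P) w.
Proof.
move=> uD PD F0; rewrite [RHS](bigID (fun w => w \in msupp P)) /=.
rewrite [X in _ + X]big1 ?addr0 => [|w wP]; last by rewrite mcoeff_outdom.
rewrite -[RHS]big_filter; apply: perm_big; apply: uniq_perm.
- exact: fset_uniq.
- exact: filter_uniq.
by move=> w; rewrite mem_filter; case: (boolP (w \in msupp P)) => // /PD ->.
Qed.

Lemma nceval_sub (V : lmodType C) (h : word d -> V) (P : ncpoly R d)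
    (D : seq (word d)) : uniq D -> {subset msupp P <= D} ->
  nceval h P = \sum_(w <- D) mcoeff w P *: h w.
Proof.
by move=> uD PD; apply: (@sum_msupp_sub V P D (fun c w => c *: h w)) => // w;
  rewrite scale0r.
Qed.

Definition supp_cover (P Q : ncpoly R d) : seq (word d) := undup (msupp P ++ msupp Q).

Lemma supp_coverP (P Q : ncpoly R d) c : let D := supp_cover P Q in
  [/\ uniq D, {subset msupp P <= D}, {subset msupp Q <= D}
    & {subset msupp (c *: P + Q) <= D}].
Proof.
rewrite /supp_cover; split=> [|w wP|w wQ|w]; rewrite ?undup_uniq ?mem_undup ?mem_cat.
- by [].
- by rewrite wP.
- by rewrite wQ orbT.
move=> /(fsubsetP (msuppD_le _ _)); rewrite in_fsetU => /orP[|->]; last by rewrite orbT.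
by move=> /(fsubsetP (msuppZ_le _ _)) ->.
Qed.

Lemma nceval_linear (V : lmodType C) (h : word d -> V) : linear (nceval (R := R) h).
Proof.
move=> c P Q; have [uD PD QD PQD] := supp_coverP P Q c.
rewrite !(nceval_sub _ uD)// scaler_sumr -big_split; apply: eq_bigr => w _ /=.
by rewrite mcoeffD mcoeffZ scalerDl scalerA.
Qed.

Lemma nceval_monom (V : lmodType C) (h : word d -> V) w :
  nceval h (ncmonom R w) = h w.
Proof.
rewrite (@nceval_sub _ _ _ [:: w])//.
  by rewrite big_seq1 /ncmonom mcoeffUU scale1r.
by move=> v; rewrite /ncmonom msuppU oner_eq0 !inE.
Qed.

End FiniteSupport.

(** * Polynomials in the shifts, their adjoints, and membership in the operator system *)

Section PolynomialOperators.
Context (R : realType) (d : nat).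
Local Notation C := (CC R).
Local Notation hardy := (hardy R d).
Local Notation operator := (operator R d).
Local Notation word := (word d).

Lemma linear_sum_op (T : operator) (I : Type) (r : seq I) (c : I -> C) (F : I -> hardy) :
  linear T -> T (\sum_(i <- r) c i *: F i) = \sum_(i <- r) c i *: T (F i).
Proof.
move=> lT; have T0 : T 0 = 0.
  by have := lT (-1) 0 0; rewrite scaler0 addr0 scaleN1r addNr.
by elim: r => [|i r IHr]; rewrite ?big_nil ?big_cons// lT IHr.
Qed.

Definition bounded_linear (T : operator) : Prop := linear T /\ sqbounded T.

Lemma bounded_linear_bounded T : bounded_linear T -> bounded_op T.
Proof. by move=> [lT bT]; exact: sqbounded_bounded. Qed.

Lemma bounded_linear0 : bounded_linear 0.
Proof. by split; [move=> c f g; rewrite scaler0 addr0|exact: sqbounded0]. Qed.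

Lemma bounded_linear_id : bounded_linear id.
Proof. by split; [|exact: sqbounded_id]. Qed.

Lemma bounded_linear_ZD c S T :
  bounded_linear S -> bounded_linear T -> bounded_linear (c *: S + T).
Proof.
move=> [lS bS] [lT bT]; split; last exact: sqbounded_ZD.
move=> a f g; rewrite !fctE lS lT !scalerDr !scalerA (mulrC c a) addrACA.
by [].
Qed.

Lemma bounded_linear_comp S T :
  bounded_linear S -> bounded_linear T -> bounded_linear (S \o T).
Proof.
move=> [lS bS] [lT bT]; split; last exact: sqbounded_comp.
by move=> a f g /=; rewrite lT lS.
Qed.

(** Boundedness of both operators is carried along, so that adjoint pairs can be combined and
    composed before [adjoint] itself is evaluated. *)
Definition is_adjoint (T S : operator) : Prop :=
  [/\ bounded_linear T, bounded_linear S & forall f g, hdot (T f) g = hdot f (S g)].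

Lemma is_adjointE T S : is_adjoint T S -> adjoint T = S.
Proof. by move=> [_ gS TS]; apply: adjointE => //; exact: bounded_linear_bounded. Qed.

Lemma hdot_linear_r (c : C) (f g h : hardy) :
  hdot f (c *: g + h) = c^* * hdot f g + hdot f h.
Proof. by rewrite hdotC hdot_linear rmorphD rmorphM /= -!hdotC. Qed.

Lemma is_adjoint_ZD c T S T' S' : is_adjoint T S -> is_adjoint T' S' ->
  is_adjoint (c *: T + T') (c^* *: S + S').
Proof.
move=> [gT gS TS] [gT' gS' TS']; split; try exact: bounded_linear_ZD.
by move=> f g; rewrite !fctE hdot_linear hdot_linear_r conjCK TS TS'.
Qed.

Lemma is_adjoint_comp T S T' S' : is_adjoint T S -> is_adjoint T' S' ->
  is_adjoint (T \o T') (S' \o S).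
Proof.
move=> [gT gS TS] [gT' gS' TS']; split; try exact: bounded_linear_comp.
by move=> f g; rewrite /= TS TS'.
Qed.

Lemma is_adjoint0 : is_adjoint 0 0.
Proof.
by split; try exact: bounded_linear0; move=> f g; rewrite hdot0l hdotC hdot0l conjC0.
Qed.

Lemma is_adjoint_id : is_adjoint id id.
Proof. by split; try exact: bounded_linear_id. Qed.

(** The operator (L^w)^*: letters accumulate on the right, because adjoints reverse products. *)
Definition Bword (w : word) : operator :=
  foldr (fun j T => T \o @backshift R d j) id (fmonom_val w).

Lemma is_adjoint_Lword w : is_adjoint (@Lword R d w) (Bword w).
Proof.
case: w; elim=> [|j s IHs]; first exact: is_adjoint_id.
apply: is_adjoint_comp IHs; split.
- by split; [exact: Lshift_linear|exact: sqbounded_Lshift].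
- by split; [exact: backshift_linear|exact: sqbounded_backshift].
- exact: Lshift_backshift.
Qed.

Definition Bpoly (P : ncpoly R d) : operator :=
  \sum_(w <- msupp P) (mcoeff w P)^* *: Bword w.

Lemma is_adjoint_Lpoly P : is_adjoint (@Lpoly R d P) (Bpoly P).
Proof.
rewrite /Lpoly /nceval /Bpoly; elim: (msupp P : seq _) => [|w s IHs].
  by rewrite !big_nil; exact: is_adjoint0.
by rewrite !big_cons; apply: is_adjoint_ZD => //; exact: is_adjoint_Lword.
Qed.

(* The operators P(L) + Q(L)^*, a linear subspace of [disk_system] that
   contains every (L^s)^* L^t. *)
Definition toeplitz_poly (T : operator) : Prop :=
  exists P Q : ncpoly R d, T = Lpoly P + Bpoly Q.

(** Uniqueness of adjoints replaces a computation with coefficients. The conjugate sits on the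
    polynomial so that the operators Q(L)^* visibly form a complex subspace. *)
Lemma Bpoly_linear (c : C) P Q : Bpoly (c^* *: P + Q) = c *: Bpoly P + Bpoly Q.
Proof.
rewrite -(is_adjointE (is_adjoint_Lpoly _)) /Lpoly nceval_linear.
have /is_adjointE -> := is_adjoint_ZD (c^*) (is_adjoint_Lpoly P) (is_adjoint_Lpoly Q).
by rewrite conjCK.
Qed.

Lemma toeplitz_poly_ZD c S T :
  toeplitz_poly S -> toeplitz_poly T -> toeplitz_poly (c *: S + T).
Proof.
move=> [P [Q ->]] [P' [Q' ->]]; exists (c *: P + P'), (c^* *: Q + Q').
by rewrite Bpoly_linear /Lpoly nceval_linear scalerDr addrACA.
Qed.

Lemma Lpoly0 : Lpoly (0 : ncpoly R d) = 0.
Proof. by rewrite /Lpoly /nceval msupp0 big_seq_fset0. Qed.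

Lemma Bpoly0 : Bpoly 0 = 0.
Proof. by rewrite /Bpoly msupp0 big_seq_fset0. Qed.

Lemma toeplitz_poly0 : toeplitz_poly 0.
Proof. by exists 0, 0; rewrite Lpoly0 Bpoly0 addr0. Qed.

Lemma toeplitz_poly_Lword w : toeplitz_poly (Lword w).
Proof. by exists (ncmonom R w), 0; rewrite Bpoly0 addr0 /Lpoly nceval_monom. Qed.

Lemma toeplitz_poly_Bword w : toeplitz_poly (Bword w).
Proof.
exists 0, (ncmonom R w); rewrite Lpoly0 add0r.
by rewrite /Bpoly /ncmonom msuppU oner_eq0 big_seq_fset1 mcoeffUU rmorph1 scale1r.
Qed.

(** The two first letters meet in the middle as L_j^* L_i, which is the identity or 0. Equal letters
    cancel one after the other until one word is exhausted, leaving a word in the shifts or the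
    adjoint of one. *)
Lemma toeplitz_poly_BL s t : toeplitz_poly (Bword t \o Lword s).
Proof.
case: s t => [s] [t]; elim: t s => [|j t IHt] s.
  exact: (toeplitz_poly_Lword (FMonom s)).
case: s => [|i s]; first exact: (toeplitz_poly_Bword (FMonom (j :: t))).
rewrite (_ : _ \o _ = (Bword (FMonom t) \o (@backshift R d j \o @Lshift R d i))
   \o Lword (FMonom s)) ; last by [].
rewrite backshift_Lshift; case: eqP => _; first exact: IHt.
rewrite (_ : _ \o _ = 0); first exact: toeplitz_poly0.
apply/funext => f /=.
have [_ [lB _] _] := is_adjoint_Lword (FMonom t).
by have := lB (-1) 0 0; rewrite scaler0 addr0 scaleN1r addNr.
Qed.

Lemma toeplitz_poly_sum (I : Type) (r : seq I) (c : I -> C) (T : I -> operator) :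
  (forall i, toeplitz_poly (T i)) -> toeplitz_poly (\sum_(i <- r) c i *: T i).
Proof.
move=> tT; elim: r => [|i r IHr]; first by rewrite big_nil; exact: toeplitz_poly0.
by rewrite big_cons; exact: toeplitz_poly_ZD.
Qed.

Lemma opclosure_refl (X : set operator) T : bounded_op T -> X T -> opclosure X T.
Proof.
move=> bT XT; split=> // e e0; exists T => // f.
by rewrite subrr hnorm0 mulr_ge0 ?sqrtr_ge0// ltW.
Qed.

(** The hypotheses on [mu] hold inside [disk_system] only, so each appeal to its linearity or
    positivity goes through this membership. *)
Lemma toeplitz_poly_disk_system T : toeplitz_poly T -> disk_system T.
Proof.
move=> [P [Q ->]]; have aP := is_adjoint_Lpoly P; have aQ := is_adjoint_Lpoly Q.
have [gP _ _] := aP; have [gQ gQ' _] := aQ.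
apply: opclosure_refl.
  by apply: bounded_linear_bounded; rewrite -[Lpoly P]scale1r; exact: bounded_linear_ZD.
exists (Lpoly P).
  by apply: opclosure_refl; [exact: bounded_linear_bounded|exists P].
exists (Lpoly Q).
  by apply: opclosure_refl; [exact: bounded_linear_bounded|exists Q].
by rewrite (is_adjointE aQ).
Qed.

End PolynomialOperators.

(** * The sesquilinear form mu(Q^* P) *)

Section MeasureForm.
Context (R : realType) (d : nat).
Local Notation C := (CC R).
Local Notation operator := (operator R d).
Local Notation word := (word d).
Context (mu : operator -> C) (mu_measure : nc_measure mu).

Lemma mu_sum (I : Type) (r : seq I) (c : I -> C) (T : I -> operator) :
  (forall i, toeplitz_poly (T i)) ->
  mu (\sum_(i <- r) c i *: T i) = \sum_(i <- r) c i * mu (T i).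
Proof.
case: mu_measure => mulin _ tT.
have ds0 := toeplitz_poly_disk_system (toeplitz_poly0 R d).
elim: r => [|i r IHr].
  rewrite !big_nil; have := mulin (-1) 0 0 ds0 ds0.
  by rewrite scaler0 addr0 mulN1r addNr.
rewrite !big_cons -IHr; apply: mulin; apply: toeplitz_poly_disk_system.
  exact: tT.
exact: toeplitz_poly_sum.
Qed.

Lemma nc_kernelE s t : nc_kernel mu s t = mu (Bword t \o Lword s).
Proof. by rewrite /nc_kernel (is_adjointE (@is_adjoint_Lword R d _)). Qed.

Lemma Bword_Lpoly t (P : ncpoly R d) :
  Bword t \o Lpoly P = \sum_(s <- msupp P) mcoeff s P *: (Bword t \o Lword s).
Proof.
have [_ [lB _] _] := @is_adjoint_Lword R d t.
apply/funext => f /=; rewrite /Lpoly /nceval !fct_sumE.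
exact: linear_sum_op.
Qed.

Lemma Bpoly_Lpoly (P Q : ncpoly R d) :
  Bpoly Q \o Lpoly P = \sum_(t <- msupp Q) (mcoeff t Q)^* *: (Bword t \o Lpoly P).
Proof. by apply/funext => f /=; rewrite /Bpoly !fct_sumE. Qed.

Lemma nc_innerE (P Q : ncpoly R d) : nc_inner mu P Q =
  \sum_(t <- msupp Q) (mcoeff t Q)^* *
    \sum_(s <- msupp P) mcoeff s P * nc_kernel mu s t.
Proof.
rewrite /nc_inner (is_adjointE (@is_adjoint_Lpoly R d _)) Bpoly_Lpoly mu_sum => [|t].
  apply: eq_bigr => t _; rewrite Bword_Lpoly.
  rewrite mu_sum => [|s]; last exact: toeplitz_poly_BL.
  by congr (_ * _); apply: eq_bigr => s _; rewrite nc_kernelE.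
by rewrite Bword_Lpoly; apply: toeplitz_poly_sum => s; exact: toeplitz_poly_BL.
Qed.

Lemma nc_inner_sub (P Q : ncpoly R d) (D E : seq word) :
  uniq D -> {subset msupp P <= D} -> uniq E -> {subset msupp Q <= E} ->
  nc_inner mu P Q = \sum_(t <- E) (mcoeff t Q)^* *
    \sum_(s <- D) mcoeff s P * nc_kernel mu s t.
Proof.
move=> uD PD uE QE; rewrite nc_innerE.
rewrite (@sum_msupp_sub R d C Q E (fun c t => c^* *
  \sum_(s <- msupp P) mcoeff s P * nc_kernel mu s t))// => [|w]; last first.
  by rewrite conjC0 mul0r.
apply: eq_bigr => t _; congr (_ * _).
by apply: (@sum_msupp_sub R d C P D (fun c s => c * nc_kernel mu s t)) => // w;
  rewrite mul0r.
Qed.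

Lemma nc_inner_linear_l (c : C) (P P' Q : ncpoly R d) :
  nc_inner mu (c *: P + P') Q = c * nc_inner mu P Q + nc_inner mu P' Q.
Proof.
have [uD PD QD PQD] := supp_coverP P P' c.
have uQ : uniq (msupp Q) by exact: fset_uniq.
rewrite !(@nc_inner_sub _ Q (supp_cover P P') (msupp Q))// mulr_sumr -big_split.
apply: eq_bigr => t _ /=; rewrite mulrCA -mulrDr; congr (_ * _).
rewrite mulr_sumr -big_split; apply: eq_bigr => s _ /=.
by rewrite mcoeffD mcoeffZ mulrDl mulrA.
Qed.

Lemma nc_inner_linear_r (c : C) (P Q Q' : ncpoly R d) :
  nc_inner mu P (c *: Q + Q') = c^* * nc_inner mu P Q + nc_inner mu P Q'.
Proof.
have [uD QD QD' QQD] := supp_coverP Q Q' c.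
have uP : uniq (msupp P) by exact: fset_uniq.
rewrite !(@nc_inner_sub P _ (msupp P) (supp_cover Q Q'))// mulr_sumr -big_split.
apply: eq_bigr => t _ /=.
by rewrite mcoeffD mcoeffZ rmorphD rmorphM mulrDl mulrA.
Qed.

Lemma nc_inner_ge0 (P : ncpoly R d) : 0 <= nc_inner mu P P.
Proof.
case: mu_measure => _ mupos; have aP := @is_adjoint_Lpoly R d P.
rewrite /nc_inner (is_adjointE aP); apply: mupos.
  apply: toeplitz_poly_disk_system; rewrite Bpoly_Lpoly; apply: toeplitz_poly_sum => t.
  by rewrite Bword_Lpoly; apply: toeplitz_poly_sum => s; exact: toeplitz_poly_BL.
(* The operator P(L)^* P(L) is positive: its value at f is the conjugate of the inner product of
   P(L) f with itself. *)
case: aP => _ _ aP f /=; rewrite hdotC -aP conj_ge0.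
exact: hdot_ge0.
Qed.

End MeasureForm.

(** * Initial segments of the shortlex order *)

Section Shortlex.
Context (d : nat).
Local Notation word := (word d).

Lemma shortlex_le_trans : transitive (@shortlex_le d).
Proof.
move=> t s u; rewrite /shortlex_le => /orP[st|/andP[/eqP st le_st]].
  by move=> /orP[tu|/andP[/eqP <- _]]; rewrite ?st// (ltn_trans st tu).
by rewrite st => /orP[->//|/andP[-> le_tu]]; rewrite (le_trans le_st le_tu) orbT.
Qed.

Lemma shortlex_le_total : total (@shortlex_le d).
Proof.
move=> s t; rewrite /shortlex_le; case: ltngtP => //= _.
exact: le_total.
Qed.

Lemma shortlex_le_anti : antisymmetric (@shortlex_le d).
Proof.
move=> s t; rewrite /shortlex_le; case: ltngtP => //= _ /le_anti st.
exact: val_inj.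
Qed.

Lemma shortlex_le_refl : reflexive (@shortlex_le d).
Proof. by move=> s; have := shortlex_le_total s s; rewrite orbb. Qed.

Lemma mem_words_upto (s w : word) : (w \in words_upto s) = shortlex_le w s.
Proof.
rewrite mem_sort mem_filter mem_words_of_length_le andb_idr//.
by rewrite /shortlex_le => /orP[/ltnW//|/andP[/eqP ->]].
Qed.

Lemma words_upto_uniq (s : word) : uniq (words_upto s).
Proof. by rewrite sort_uniq; apply: filter_uniq; exact: words_of_length_le_uniq. Qed.

Lemma words_upto_sorted (s : word) : sorted (@shortlex_le d) (words_upto s).
Proof. exact: (sort_sorted shortlex_le_total). Qed.

(** [orthopoly] reruns Gram-Schmidt on [words_upto s] for every [s]. This identifies that run with
    an initial segment of the run for a later word, so all runs produce one consistent family. *)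
Lemma words_upto_prefix (t s : word) ws rest :
  words_upto t = rcons ws s ++ rest -> words_upto s = rcons ws s.
Proof.
move=> tE; have := words_upto_uniq t; have := words_upto_sorted t.
rewrite sorted_pairwise; last exact: shortlex_le_trans.
rewrite tE pairwise_cat cat_uniq => /and3P[/allrelP le_rest pw _] /and3P[uws _ _].
have ws_s w : w \in rcons ws s -> shortlex_le w s.
  rewrite mem_rcons inE => /orP[/eqP ->|wws]; first exact: shortlex_le_refl.
  by move: pw; rewrite pairwise_rcons => /andP[/allP/(_ w wws)].
apply: (sorted_eq shortlex_le_trans shortlex_le_anti).
- exact: words_upto_sorted.
- by rewrite sorted_pairwise//; exact: shortlex_le_trans.
apply: uniq_perm => //; first exact: words_upto_uniq.
move=> w; rewrite mem_words_upto; apply/idP/idP => [ws'|]; last exact: ws_s.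
have s_in : s \in rcons ws s by rewrite mem_rcons inE eqxx.
have : w \in words_upto t.
  rewrite mem_words_upto (shortlex_le_trans ws')// -mem_words_upto tE mem_cat.
  by rewrite s_in.
rewrite tE mem_cat => /orP[//|w_rest].
have sw := le_rest _ _ s_in w_rest.
by rewrite (@shortlex_le_anti w s) ?s_in// ws' sw.
Qed.

End Shortlex.

Lemma lexi_le_nseq_max d (s : seq 'I_d.+1) :
  ((s : seqlexi 'I_d.+1) <= (nseq (size s) ord_max : seqlexi 'I_d.+1))%O.
Proof.
elim: s => [|i s IHs] //=; rewrite lexi_cons IHs implybT andbT.
exact: leq_ord.
Qed.

(** The word d...d dominates all words of its length, so the segments ending at sigma(n) are the
    balls of words: they are nested and exhaust all words. *)
Lemma mem_words_upto_last d n (w : word d.+1) :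
  (w \in words_upto (last_word d n)) = (size w <= n)%N.
Proof.
rewrite mem_words_upto /shortlex_le /= size_nseq.
by case: ltngtP => [_|_|<-] //=; exact: lexi_le_nseq_max.
Qed.

(** * Positive sesquilinear forms *)

Section SesquilinearForm.
Context (C : numClosedFieldType) (V : lmodType C) (ip : V -> V -> C).
Hypothesis ip_linear_l : forall c u v w, ip (c *: u + v) w = c * ip u w + ip v w.
Hypothesis ip_linear_r : forall c u v w, ip u (c *: v + w) = c^* * ip u v + ip u w.
Hypothesis ip_ge0 : forall v, 0 <= ip v v.

Lemma ip0l u : ip 0 u = 0.
Proof. by have := ip_linear_l (-1) 0 0 u; rewrite scaler0 addr0 mulN1r addNr. Qed.

Lemma ip0r u : ip u 0 = 0.
Proof.
by have := ip_linear_r (-1) u 0 0; rewrite scaler0 addr0 rmorphN1 mulN1r addNr.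
Qed.

Lemma ipZl c u v : ip (c *: u) v = c * ip u v.
Proof. by rewrite -[_ *: _]addr0 ip_linear_l ip0l addr0. Qed.

Lemma ipZr c u v : ip u (c *: v) = c^* * ip u v.
Proof. by rewrite -[_ *: _]addr0 ip_linear_r ip0r addr0. Qed.

Lemma ip_suml (I : Type) (r : seq I) (c : I -> C) (F : I -> V) v :
  ip (\sum_(i <- r) c i *: F i) v = \sum_(i <- r) c i * ip (F i) v.
Proof.
elim: r => [|i r IHr]; first by rewrite !big_nil ip0l.
by rewrite !big_cons ip_linear_l IHr.
Qed.

Lemma ip_expand c u v :
  ip (c *: u + v) (c *: u + v) =
  (c * c^* * ip u u + ip v v) + (c * ip u v + c^* * ip v u).
Proof. by rewrite ip_linear_l !ip_linear_r; ring. Qed.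

(** In the alternating sum the diagonal terms cancel, and the weights 1 and 'i cancel [ip u v] while
    reinforcing [ip v u]. *)
Lemma ip_polarization u v : let q c := ip (c *: u + v) (c *: u + v) in
  ip v u = 4^-1 * (q 1 - q (-1) + 'i * (q 'i - q (- 'i))).
Proof.
have Nconj (z : C) : (- z)^* = - z^* by exact: rmorphN.
rewrite /= !ip_expand !Nconj conjC1 conjCi opprK.
move: (ip u u) (ip u v) (ip v u) (ip v v) => a x y b.
have ii : 'i * 'i = -1 :> C by rewrite -expr2 sqrCi.
rewrite [X in 4^-1 * X](_ : _ = 2 * (x + y) + 2 * ('i * 'i) * (x - y)); last by ring.
by rewrite ii; field.
Qed.

Lemma ip_cross_real c u v : c * ip u v + c^* * ip v u \is Num.real.
Proof.
have -> : c * ip u v + c^* * ip v u =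
    ip (c *: u + v) (c *: u + v) - (c * c^* * ip u u + ip v v).
  by rewrite ip_expand addrAC subrr add0r.
by rewrite rpredB// ?ger0_real// addr_ge0// mulr_ge0// mul_conjC_ge0.
Qed.

Lemma ip_conj u v : ip v u = (ip u v)^*.
Proof.
(* Real cross terms at c = 1 and at c = 'i say that x + y and 'i (x - y) are real, which together
   force y = x^*. *)
have /CrealP := ip_cross_real 1 u v; have /CrealP := ip_cross_real 'i u v.
rewrite !rmorphD !rmorphM /= !conjCK !rmorph1 !mul1r conjCi.
move: (ip u v) (ip v u) => x y hi h1.
have hi' : x^* - y^* = y - x.
  apply: (mulfI (neq0Ci C)).
  have -> : 'i * (x^* - y^*) = - (- 'i * x^* + 'i * y^*) by ring.
  by rewrite hi; ring.
have : 2 * x^* = 2 * y.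
  have -> : 2 * x^* = (x^* + y^*) + (x^* - y^*) by ring.
  by rewrite h1 hi'; ring.
by move=> /mulfI <-//; rewrite pnatr_eq0.
Qed.

(** The degenerate case of Cauchy-Schwarz: otherwise a large multiple of [v] added to [u] would make
    the form negative. *)
Lemma ip_null u v : ip v v = 0 -> ip v u = 0.
Proof.
move=> v0; apply/eqP/negPn/negP => vu0.
pose y := ip v u; pose n2 := y * y^*.
have n2_gt0 : 0 < n2 by rewrite mul_conjC_gt0.
(* Chosen so that t n2 = [ip u u] + 1: the form at u - t y^* v is then [ip u u] - 2 t n2 =
   -([ip u u] + 2), which is negative. *)
pose t := (ip u u + 1) / n2.
have t_ge0 : 0 <= t by rewrite divr_ge0 ?addr_ge0 ?ip_ge0 ?ltW.
have := ip_ge0 ((- (t * y^*)) *: v + u); rewrite ip_expand v0 mulr0 add0r.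
rewrite [ip u v]ip_conj -/y rmorphN rmorphM /= conjCK (CrealP (ger0_real t_ge0)).
have -> : ip u u + (- (t * y^*) * y + - (t * y) * y^*) = ip u u - (t * n2) - (t * n2).
  by rewrite /n2; ring.
rewrite /t divfK ?gt_eqF//.
have -> : ip u u - (ip u u + 1) - (ip u u + 1) = - (ip u u + 2) by ring.
by rewrite oppr_ge0 lt_geF// ltr_wpDl.
Qed.

End SesquilinearForm.

Lemma gram_schmidt_rcons (C : numClosedFieldType) (V : lmodType C)
    (f : V -> V -> C) vs v :
  gram_schmidt f (rcons vs v) = rcons (gram_schmidt f vs)
    (normalize f (v - \sum_(e <- gram_schmidt f vs) f v e *: e)).
Proof. by rewrite /gram_schmidt foldl_rcons. Qed.

(** * Gram-Schmidt on monomials *)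

Section GramSchmidtMonomials.
Context (R : realType) (d : nat).
Local Notation C := (CC R).
Local Notation word := (word d).
Local Notation ncpoly := (ncpoly R d).
Local Notation Zw := (@ncmonom R d).
Context (ip : ncpoly -> ncpoly -> C).
Hypothesis ip_lin_l : forall c u v w, ip (c *: u + v) w = c * ip u w + ip v w.
Hypothesis ip_lin_r : forall c u v w, ip u (c *: v + w) = c^* * ip u v + ip u w.
Hypothesis ip_ge0 : forall v, 0 <= ip v v.
Hypothesis ip_def : forall v, ip v v = 0 -> v = 0.

Lemma mcoeff_sum (I : Type) (r : seq I) (c : I -> C) (F : I -> ncpoly) w :
  mcoeff w (\sum_(i <- r) c i *: F i) = \sum_(i <- r) c i * mcoeff w (F i).
Proof.
elim: r => [|i r IHr]; first by rewrite !big_nil mcoeff0.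
by rewrite !big_cons mcoeffD mcoeffZ IHr.
Qed.

(** The three conclusions need a joint induction: the support bound keeps the residual of a new
    monomial from vanishing, and the expansion of earlier monomials makes them orthogonal to the new
    vector. *)
Lemma gram_schmidt_spec (f : word -> ncpoly) ws : uniq ws ->
  gram_schmidt ip [seq Zw w | w <- ws] = [seq f w | w <- ws] ->
  [/\ {in ws &, forall s t, ip (f s) (f t) = (s == t)%:R},
      {in ws, forall w, Zw w = \sum_(t <- ws) ip (Zw w) (f t) *: f t} &
      {in ws, forall s, {subset msupp (f s) <= ws}}].
Proof.
elim/last_ind: ws => [_ _|ws s IHws]; first by split.
rewrite rcons_uniq => /andP[sws uws].
rewrite !map_rcons gram_schmidt_rcons => /rcons_inj[gsE fsE].
have [ortho span supp] := IHws uws gsE.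
rewrite gsE big_map in fsE.
pose r := Zw s - \sum_(t <- ws) ip (Zw s) (f t) *: f t.
(* Earlier vectors are supported on earlier words, so subtracting them leaves the coefficient at [s]
   untouched. *)
have rs : mcoeff s r = 1.
  rewrite mcoeffB mcoeff_sum /ncmonom mcoeffUU big_seq big1 ?subr0// => t tws.
  rewrite mcoeff_outdom ?mulr0//; apply: contra sws; exact: supp.
have r_neq0 : ip r r != 0.
  apply/eqP => /ip_def r0; move/eqP: rs.
  by rewrite r0 mcoeff0 eq_sym oner_eq0.
have rr_gt0 : 0 < ip r r by rewrite lt_def r_neq0 ip_ge0.
pose c := sqrtC (ip r r).
have c_gt0 : 0 < c by rewrite sqrtC_gt0.
have c_real : c^* = c by apply/CrealP; rewrite gtr0_real.
have fs : f s = c^-1 *: r by rewrite -fsE.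
have rf t : t \in ws -> ip r (f t) = 0.
  move=> tws; rewrite /r -scaleN1r addrC ip_lin_l (ip_suml ip_lin_l).
  rewrite (bigD1_seq t tws uws) /= (ortho _ _ tws tws) eqxx mulr1.
  rewrite big_seq_cond big1 => [|u].
    by rewrite addr0 mulN1r addNr.
  by move=> /andP[uw /negPf ut]; rewrite ortho// ut mulr0.
have fst_ t : t \in ws -> ip (f s) (f t) = 0.
  by move=> tws; rewrite fs (ipZl ip_lin_l) rf// mulr0.
have fts t : t \in ws -> ip (f t) (f s) = 0.
  by move=> tws; rewrite (ip_conj ip_lin_l ip_lin_r ip_ge0) fst_// conjC0.
have cc : c * c = ip r r by rewrite -expr2 sqrtCK.
have c0 : c != 0 by rewrite gt_eqF.
have fss : ip (f s) (f s) = 1.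
  rewrite fs (ipZl ip_lin_l) (ipZr ip_lin_r) fmorphV /= c_real -cc.
  by field.
split.
- move=> a b; rewrite !mem_rcons !inE => /orP[/eqP ->|aws] /orP[/eqP ->|bws].
  + by rewrite eqxx fss.
  + by rewrite fst_//; case: eqP bws sws => // ->  ->.
  + by rewrite fts//; case: eqP aws sws => // <- ->.
  + exact: ortho.
- move=> w; rewrite mem_rcons inE big_rcons /= => /orP[/eqP ->|wws].
  (* Only the residual contributes to the inner product, which equals [c]; then c times c^-1 r gives
     back r. *)
  + have -> : ip (Zw s) (f s) *: f s = r.
      have -> : Zw s = 1 *: r + \sum_(t <- ws) ip (Zw s) (f t) *: f t.
        by rewrite scale1r subrK.
      rewrite ip_lin_l (ip_suml ip_lin_l) big_seq big1 => [|t tws]; last first.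
        by rewrite fts// mulr0.
      rewrite mul1r addr0 fs (ipZr ip_lin_r) fmorphV /= c_real -cc scalerA.
      by rewrite (_ : _ * _ = 1) ?scale1r//; field.
    by rewrite /r addrC subrK.
  + rewrite (_ : ip (Zw w) (f s) = 0) ?scale0r ?addr0; first exact: span.
    rewrite (span _ wws) (ip_suml ip_lin_l) big_seq big1// => t tws.
    by rewrite fts// mulr0.
- move=> t; rewrite mem_rcons inE => /orP[/eqP ->|tws] w; last first.
    by move=> /(supp _ tws); rewrite mem_rcons inE orbC => ->.
  rewrite -mcoeff_neq0 mem_rcons inE; apply: contraR; rewrite negb_or => /andP[ws_ wws].
  rewrite fs mcoeffZ mcoeffB mcoeff_sum /ncmonom mcoeffU.
  rewrite [s == w]eq_sym (negPf ws_) mulr0n.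
  rewrite big_seq big1 ?subr0 ?mulr0// => u u_ws.
  by rewrite mcoeff_outdom ?mulr0//; apply: contra wws; exact: supp u_ws _.
Qed.

End GramSchmidtMonomials.

(** * The orthonormal polynomials of the measure *)

Section OrthonormalPolynomials.
Context (R : realType) (d : nat).
Local Notation C := (CC R).
Local Notation word := (word d.+1).
Local Notation ncpoly := (ncpoly R d.+1).
Context (mu : operator R d.+1 -> C) (mu_measure : nc_measure mu).
Hypothesis mu_nontrivial : nontrivial_nc_measure mu.
Local Notation ip := (nc_inner mu).
Local Notation Zw := (@ncmonom R d.+1).
Local Notation phi := (orthopoly mu).

Let ip_lin_l : forall c u v w, ip (c *: u + v) w = c * ip u w + ip v w :=
  nc_inner_linear_l mu_measure.
Let ip_lin_r : forall c u v w, ip u (c *: v + w) = c^* * ip u v + ip u w :=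
  nc_inner_linear_r mu_measure.
Let ip_ge0 : forall v, 0 <= ip v v := nc_inner_ge0 mu_measure.

Lemma msupp_sub_words_upto (P : ncpoly) :
  exists n, {subset msupp P <= words_upto (last_word d n)}.
Proof.
exists (\max_(w <- msupp P) size w) => w wP; rewrite mem_words_upto_last.
exact: (@leq_bigmax_seq _ (msupp P : seq word) xpredT (fun v : word => size v) w).
Qed.

(** A null polynomial is orthogonal to every monomial, so its coefficient row lies in the left
    kernel of a kernel matrix, which non-triviality makes invertible. *)
Lemma nc_inner_def (P : ncpoly) : ip P P = 0 -> P = 0.
Proof.
move=> P0; have [n Pn] := msupp_sub_words_upto P.
pose s0 := last_word d n; pose ws := words_upto s0.
have uws : uniq ws by exact: words_upto_uniq.
have := mu_nontrivial s0; rewrite -/ws /=; set M := (X in X \in unitmx) => uM.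
pose v : 'rV[C]_(size ws) := \row_i mcoeff (nth s0 ws i) P.
have vM : v *m M = 0.
  apply/rowP => j; rewrite !mxE.
  have := ip_null ip_lin_l ip_lin_r ip_ge0 (Zw (nth s0 ws j)) P0.
  rewrite (nc_inner_sub mu_measure uws Pn (E := [:: nth s0 ws j]))//; last first.
    by move=> w; rewrite /ncmonom msuppU oner_eq0 !inE.
  rewrite big_seq1 /ncmonom mcoeffUU rmorph1 mul1r => vM0; apply: etrans vM0.
  rewrite (big_nth s0) big_mkord; apply: eq_bigr => i _.
  by rewrite !mxE.
have v0 : v = 0 by rewrite -[v](mulmxK uM) vM mul0mx.
apply/malgP => w; rewrite mcoeff0.
case: (boolP (w \in msupp P)) => [/Pn wws|]; last first.
  exact: mcoeff_outdom.
have wi : (index w ws < size ws)%N by rewrite index_mem.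
have := congr1 (fun u : 'rV_(size ws) => u 0 (Ordinal wi)) v0.
by rewrite !mxE /= nth_index.
Qed.

Lemma gram_schmidt_orthopoly (t : word) ws rest : words_upto t = ws ++ rest ->
  gram_schmidt ip [seq Zw w | w <- ws] = [seq phi w | w <- ws].
Proof.
elim/last_ind: ws rest => [//|ws s IHws] rest tE.
have sE := words_upto_prefix tE.
rewrite !map_rcons -(IHws (s :: rest)) -?cat_rcons// gram_schmidt_rcons.
by rewrite /orthopoly sE map_rcons gram_schmidt_rcons last_rcons.
Qed.

Local Notation W n := (words_upto (last_word d n)).

Lemma orthopoly_spec n :
  [/\ {in W n &, forall s t, ip (phi s) (phi t) = (s == t)%:R},
      {in W n, forall w, Zw w = \sum_(t <- W n) ip (Zw w) (phi t) *: phi t} &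
      {in W n, forall s, {subset msupp (phi s) <= W n}}].
Proof.
apply: (gram_schmidt_spec ip_lin_l ip_lin_r ip_ge0 nc_inner_def).
  exact: words_upto_uniq.
by apply: (@gram_schmidt_orthopoly (last_word d n) _ [::]); rewrite cats0.
Qed.

Lemma orthopoly_expansion n (P : ncpoly) : {subset msupp P <= W n} ->
  P = \sum_(t <- W n) ip P (phi t) *: phi t.
Proof.
move=> Pn; have [_ span _] := orthopoly_spec n.
have PE : P = \sum_(w <- msupp P) mcoeff w P *: Zw w.
  rewrite [LHS]monalgE; apply: eq_bigr => w _.
  by apply/malgP => v; rewrite mcoeffZ /ncmonom !mcoeffU mulr_natr.
rewrite [in RHS]PE; under [RHS]eq_bigr do rewrite (ip_suml ip_lin_l) scaler_suml.
rewrite exchange_big [LHS]PE big_seq [RHS]big_seq; apply: eq_bigr => w wP /=.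
rewrite {1}(span w (Pn _ wP)) scaler_sumr; apply: eq_bigr => t _.
by rewrite scalerA.
Qed.

(** Only [P] is expanded; Hermitian symmetry turns the remaining factors into conjugate coefficients
    of [Q]. *)
Lemma nc_inner_parseval n (P Q : ncpoly) : {subset msupp P <= W n} ->
  ip P Q = \sum_(t <- W n) ip P (phi t) * (ip Q (phi t))^*.
Proof.
move=> Pn; rewrite {1}(orthopoly_expansion Pn) (ip_suml ip_lin_l).
by apply: eq_bigr => t _; rewrite [ip _ Q](ip_conj ip_lin_l ip_lin_r ip_ge0).
Qed.

End OrthonormalPolynomials.

(** * Conjugate transposes and positive semidefinite matrices *)

Section MatrixAdjoint.
Context (C : numClosedFieldType).

Lemma adjmxM m n p (A : 'M[C]_(m, n)) (B : 'M[C]_(n, p)) :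
  (A *m B)^t* = B^t* *m A^t*.
Proof. by rewrite trmx_mul map_mxM. Qed.

Lemma adjmxB m n (A B : 'M[C]_(m, n)) : (A - B)^t* = A^t* - B^t*.
Proof. by apply/matrixP => i j; rewrite !mxE rmorphB. Qed.

Lemma adjmx_sum m n (I : Type) (r : seq I) (F : I -> 'M[C]_(m, n)) :
  (\sum_(i <- r) F i)^t* = \sum_(i <- r) (F i)^t*.
Proof.
elim: r => [|i r IHr].
  by rewrite !big_nil; apply/matrixP => i j; rewrite !mxE conjC0.
by rewrite !big_cons -IHr; apply/matrixP => a b; rewrite !mxE rmorphD.
Qed.

Lemma hermsymmxP n (M : 'M[C]_n) : reflect (M^t* = M) (M \is hermsymmx).
Proof.
by apply: (iffP (is_hermitianmxP _ _ _)); rewrite expr0 scale1r.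
Qed.

Lemma row_adjmx_ge0 n (v : 'rV[C]_n) : 0 <= (v *m v^t*) 0 0.
Proof. by rewrite !mxE sumr_ge0// => j _; rewrite !mxE mul_conjC_ge0. Qed.

Lemma row_adjmx_eq0 n (v : 'rV[C]_n) : (v *m v^t*) 0 0 = 0 -> v = 0.
Proof.
rewrite mxE => /eqP; rewrite psumr_eq0 => [/allP v0|j _]; last first.
  by rewrite !mxE mul_conjC_ge0.
apply/rowP => j; have := v0 j (mem_index_enum _); rewrite !mxE implyTb.
by rewrite mul_conjC_eq0 => /eqP.
Qed.

Lemma psdmx_adjM n (B : 'M[C]_n) : psdmx (B^t* *m B).
Proof.
split; first by apply/hermsymmxP; rewrite adjmxM trmxCK.
move=> v; rewrite (_ : _ *m _ = (v *m B^t*) *m (v *m B^t*)^t*).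
  exact: row_adjmx_ge0.
by rewrite adjmxM trmxCK !mulmxA.
Qed.

Lemma psdmx0 n : psdmx (0 : 'M[C]_n).
Proof.
split; last by move=> v; rewrite mulmx0 mul0mx mxE.
by apply/hermsymmxP/matrixP => i j; rewrite !mxE conjC0.
Qed.

Lemma psdmxD n (M N : 'M[C]_n) : psdmx M -> psdmx N -> psdmx (M + N).
Proof.
move=> [/hermsymmxP hM pM] [/hermsymmxP hN pN]; split.
  apply/hermsymmxP; rewrite -{2}hM -{2}hN.
  by apply/matrixP => i j; rewrite !mxE rmorphD.
by move=> v; rewrite mulmxDr mulmxDl mxE addr_ge0.
Qed.

Lemma psdmx_sum n (I : Type) (r : seq I) (F : I -> 'M[C]_n) :
  (forall i, psdmx (F i)) -> psdmx (\sum_(i <- r) F i).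
Proof. by move=> pF; apply: big_ind => //; [exact: psdmx0|exact: psdmxD]. Qed.

(* Expand [sum (a i - b i)^* (a i - b i)] with [b i = (F i)^* G^-1]: the cross
   terms and [sum (b i)^* b i] are all equal to [G^-1]. *)
Lemma invmx_gram_le n (I : Type) (r : seq I) (F a : I -> 'M[C]_n) :
  let G := \sum_(i <- r) F i *m (F i)^t* in
  G \in unitmx -> \sum_(i <- r) F i *m a i = 1%:M ->
  loewner_le (invmx G) (\sum_(i <- r) (a i)^t* *m a i).
Proof.
move=> G uG Fa; pose H := invmx G.
have hG : G^t* = G.
  by rewrite /G adjmx_sum; apply: eq_bigr => i _; rewrite adjmxM trmxCK.
have hH : H^t* = H.
  have e1 : (1%:M : 'M[C]_n)^t* = 1%:M by rewrite trmx1 map_mx1.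
  by rewrite -[LHS]mulmx1 -(mulmxV uG) mulmxA -{1}hG -adjmxM mulmxV// e1 mul1mx.
have aF : \sum_(i <- r) (a i)^t* *m (F i)^t* = 1%:M.
  transitivity ((\sum_(i <- r) F i *m a i)^t*); last by rewrite Fa trmx1 map_mx1.
  by rewrite adjmx_sum; apply: eq_bigr => i _; rewrite adjmxM.
rewrite /loewner_le -/H.
suff -> : \sum_(i <- r) (a i)^t* *m a i - H =
    \sum_(i <- r) (a i - (F i)^t* *m H)^t* *m (a i - (F i)^t* *m H).
  by apply: psdmx_sum => i; exact: psdmx_adjM.
have -> : \sum_(i <- r) (a i - (F i)^t* *m H)^t* *m (a i - (F i)^t* *m H) =
   \sum_(i <- r) ((a i)^t* *m a i - (a i)^t* *m (F i)^t* *m H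
     - H *m (F i *m a i) + H *m (F i *m (F i)^t*) *m H).
  apply: eq_bigr => i _; rewrite adjmxB adjmxM trmxCK hH mulmxBr !mulmxBl !mulmxA.
  by rewrite opprB addrA addrAC; congr (_ + _); exact: addrAC.
rewrite big_split /= !sumrB -!mulmx_suml -!mulmx_sumr aF Fa mul1mx mulmx1.
by rewrite -/G mulVmx// mul1mx -addrA addNr addr0.
Qed.

End MatrixAdjoint.

Lemma sum_seq_delta (I : eqType) (K : nzSemiRingType) (r : seq I) (s : I)
    (c x : I -> K) : uniq r -> s \in r ->
  (forall t, t \in r -> x t = (t == s)%:R) -> \sum_(t <- r) c t * x t = c s.
Proof.
move=> ur sr xE; rewrite (bigD1_seq s sr ur) /= xE// eqxx mulr1.
rewrite big_seq_cond big1 ?addr0// => t /andP[tr /negPf ts].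
by rewrite xE// ts mulr0.
Qed.

(** * The extremal problem in bounded degree *)

Section ChristoffelMinimum.
Context (R : realType) (d : nat).
Local Notation C := (CC R).
Local Notation word := (word d.+1).
Local Notation ncpoly := (ncpoly R d.+1).
Context (mu : operator R d.+1 -> C) (mu_measure : nc_measure mu).
Hypothesis mu_nontrivial : nontrivial_nc_measure mu.
Local Notation ip := (nc_inner mu).
Local Notation phi := (orthopoly mu).
Local Notation W n := (words_upto (last_word d n)).
Context (k : nat) (A : 'I_d.+1 -> 'M[C]_k).
Local Notation ev := (nceval (mxword A)).

Definition degree_le (n : nat) (Q : 'M[ncpoly]_k) : Prop :=
  forall i j, {subset msupp (Q i j) <= W n}.

Lemma msupp_sub_ncmx_supp (Q : 'M[ncpoly]_k) i j : {subset msupp (Q i j) <= ncmx_supp Q}.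
Proof.
move=> w wQ; have := @bigfcup_sup _ _ (index_enum _) (i, j) xpredT
  (fun ij : 'I_k * 'I_k => msupp (Q ij.1 ij.2)) (mem_index_enum _) isT.
by move=> /fsubsetP; apply.
Qed.

Lemma degree_le_exists Q : exists n, degree_le n Q.
Proof.
exists (\max_(w <- ncmx_supp Q) size w) => i j w /msupp_sub_ncmx_supp wQ.
rewrite mem_words_upto_last.
exact: (@leq_bigmax_seq _ (ncmx_supp Q : seq word) xpredT (fun v : word => size v) w).
Qed.

Lemma nceval_sum (V : lmodType C) (h : word -> V) (I : Type) (r : seq I)
    (c : I -> C) (F : I -> ncpoly) :
  nceval h (\sum_(i <- r) c i *: F i) = \sum_(i <- r) c i *: nceval h (F i).
Proof.
elim: r => [|i r IHr]; last by rewrite !big_cons nceval_linear IHr.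
by rewrite !big_nil /nceval msupp0 big_seq_fset0.
Qed.

(* The coefficient [a_s] of the expansion [Q = \sum_s phi_s (x) a_s]. *)
Definition ortho_coef (Q : 'M[ncpoly]_k) (s : word) : 'M[C]_k :=
  \matrix_(i, j) ip (Q i j) (phi s).

Lemma ortho_coef_sum n (b : word -> 'M[C]_k) s : s \in W n ->
  ortho_coef (\matrix_(i, j) \sum_(t <- W n) b t i j *: phi t) s = b s.
Proof.
move=> sW; have [ortho _ _] := orthopoly_spec mu_measure mu_nontrivial n.
apply/matrixP => i j; rewrite mxE mxE (ip_suml (nc_inner_linear_l mu_measure)).
apply: sum_seq_delta => //; first exact: words_upto_uniq.
by move=> t tW; exact: ortho.
Qed.

Lemma ncmx_eval_ortho n Q : degree_le n Q ->
  ncmx_eval A Q = \sum_(s <- W n) ev (phi s) *m ortho_coef Q s.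
Proof.
move=> Qn; apply/matrixP => i j.
(* Coefficient matrices stand to the right of A^w, so the row index of [Q] is contracted with the
   column index of the evaluation. *)
transitivity (\sum_l (ev (Q l j)) i l).
  rewrite /ncmx_eval summxE; under eq_bigr do rewrite mxE.
  rewrite exchange_big; apply: eq_bigr => l _ /=.
  rewrite (nceval_sub _ (fset_uniq _) (@msupp_sub_ncmx_supp Q l j)) summxE.
  by apply: eq_bigr => w _; rewrite !mxE mulrC.
rewrite summxE; under [RHS]eq_bigr do rewrite mxE.
rewrite exchange_big; apply: eq_bigr => l _ /=.
rewrite {1}(orthopoly_expansion mu_measure mu_nontrivial (Qn l j)) nceval_sum summxE.
by apply: eq_bigr => s _; rewrite !mxE mulrC.
Qed.

Lemma ncmx_sqform_ortho n Q : degree_le n Q ->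
  ncmx_sqform mu Q = \sum_(s <- W n) (ortho_coef Q s)^t* *m ortho_coef Q s.
Proof.
move=> Qn; apply/matrixP => i j.
(* Each entry is a sum of scalar inner products down two columns of [Q], which reduces the claim to
   the scalar Parseval identity. *)
transitivity (\sum_l ip (Q l j) (Q l i)).
  rewrite /ncmx_sqform summxE.
  under eq_bigr => s _.
    rewrite summxE; under eq_bigr => t _ do rewrite !mxE mulr_sumr.
    rewrite exchange_big; over.
  rewrite exchange_big; apply: eq_bigr => l _ /=.
  have u : uniq (ncmx_supp Q) by exact: fset_uniq.
  rewrite (nc_inner_sub mu_measure u (@msupp_sub_ncmx_supp Q l j)
    u (@msupp_sub_ncmx_supp Q l i)).
  apply: eq_bigr => s _; rewrite mulr_sumr; apply: eq_bigr => t _.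
  by rewrite !mxE /nc_kernel [LHS]mulrC -mulrA.
rewrite summxE; under [RHS]eq_bigr do rewrite mxE.
rewrite exchange_big; apply: eq_bigr => l _ /=.
rewrite (nc_inner_parseval mu_measure mu_nontrivial _ (Qn l j)).
by apply: eq_bigr => s _; rewrite !mxE mulrC.
Qed.

Definition christoffel_gram n : 'M[C]_k :=
  \sum_(s <- W n) ev (phi s) *m (ev (phi s))^t*.

Lemma christoffelE n : christoffel mu n A = invmx (christoffel_gram n).
Proof. by []. Qed.

(* If [v G = 0] then [v phi_s(A) = 0] for all [s], hence [v 1(A) = 0]. *)
Lemma christoffel_gram_unit n : christoffel_gram n \in unitmx.
Proof.
rewrite -row_free_unit; apply: inj_row_free => v vG.
have vphi s : s \in W n -> v *m ev (phi s) = 0.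
  move=> sW; apply: row_adjmx_eq0.
  have : (v *m christoffel_gram n *m v^t*) 0 0 = 0 by rewrite vG mul0mx mxE.
  rewrite /christoffel_gram mulmx_sumr mulmx_suml summxE => /eqP.
  rewrite psumr_eq0 => [/allP/(_ s sW)|t _].
    by rewrite implyTb adjmxM !mulmxA => /eqP.
  by rewrite mulmxA -mulmxA -adjmxM row_adjmx_ge0.
pose e0 : word := FMonom [::].
have e0W : {subset msupp (ncmonom R e0) <= W n}.
  move=> w; rewrite /ncmonom msuppU oner_eq0 inE => /eqP ->.
  by rewrite mem_words_upto_last.
have := nceval_monom (mxword A) e0.
rewrite (orthopoly_expansion mu_measure mu_nontrivial e0W) nceval_sum /= => one.
rewrite -[v]mulmx1 -[1%:M]/(mxword A e0) -one mulmx_sumr big_seq big1// => s sW.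
by rewrite -scalemxAr vphi// scaler0.
Qed.

Lemma christoffel_le_sqform n Q : degree_le n Q -> ncmx_eval A Q = 1%:M ->
  loewner_le (christoffel mu n A) (ncmx_sqform mu Q).
Proof.
move=> Qn; rewrite (ncmx_eval_ortho Qn) (ncmx_sqform_ortho Qn) christoffelE.
exact: (invmx_gram_le (christoffel_gram_unit n)).
Qed.

Lemma christoffel_attained n : exists Q : 'M[ncpoly]_k,
  [/\ degree_le n Q, ncmx_eval A Q = 1%:M & ncmx_sqform mu Q = christoffel mu n A].
Proof.
have uG := christoffel_gram_unit n; set G := christoffel_gram n in uG *.
pose b s := (ev (phi s))^t* *m invmx G.
pose Q : 'M[ncpoly]_k := \matrix_(i, j) \sum_(s <- W n) b s i j *: phi s.
have [ortho _ supp] := orthopoly_spec mu_measure mu_nontrivial n.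
have Qn : degree_le n Q.
  move=> i j w; rewrite mxE -mcoeff_neq0; apply: contraR => wW.
  rewrite mcoeff_sum big_seq big1// => s sW.
  by rewrite mcoeff_outdom ?mulr0//; apply: contra wW; exact: supp.
have Qb s : s \in W n -> ortho_coef Q s = b s.
  exact: ortho_coef_sum.
have Q1 : ncmx_eval A Q = 1%:M.
  rewrite (ncmx_eval_ortho Qn) big_seq.
  under eq_bigr => s sW do rewrite Qb// mulmxA.
  by rewrite -big_seq -mulmx_suml mulmxV.
exists Q; split=> //.
(* With only the left factor expanded, the sum rebuilds Q(A) = I, and the value collapses to the
   conjugate transpose of G^-1. *)
have hb s : s \in W n -> (ortho_coef Q s)^t* = (invmx G)^t* *m ev (phi s).
  by move=> sW; rewrite Qb// adjmxM trmxCK.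
rewrite (ncmx_sqform_ortho Qn) big_seq.
under eq_bigr => s sW do rewrite hb// -mulmxA.
rewrite -big_seq -mulmx_sumr -(ncmx_eval_ortho Qn) Q1 mulmx1.
have hG : G^t* = G.
  by rewrite /G adjmx_sum; apply: eq_bigr => i _; rewrite adjmxM trmxCK.
by rewrite trmx_inv map_invmx hG.
Qed.

Lemma christoffel_psd n : psdmx (christoffel mu n A).
Proof.
have [Q [Qn _ <-]] := christoffel_attained n.
by rewrite (ncmx_sqform_ortho Qn); apply: psdmx_sum => s; exact: psdmx_adjM.
Qed.

(** The minimiser of degree at most [n] is a competitor in degree at most [m]. *)
Lemma christoffel_antitone n m : (n <= m)%N ->
  loewner_le (christoffel mu m A) (christoffel mu n A).
Proof.
move=> nm; have [Q [Qn Q1 <-]] := christoffel_attained n.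
apply: christoffel_le_sqform => // i j w /Qn; rewrite !mem_words_upto_last.
by move=> /leq_trans; apply.
Qed.

End ChristoffelMinimum.

(** * Limits of matrices in the Loewner order *)

Section LoewnerLimits.
Context (R : realType) (k : nat).
Local Notation C := (CC R).
Implicit Types (u : nat -> 'M[C]_k) (l : 'M[C]_k).

Lemma cvg_mx_entryP u l :
  u @ \oo --> l <-> forall i j, (fun n => u n i j) @ \oo --> l i j.
Proof.
split=> [/cvg_mx_entourageP ul i j|ul].
  apply/cvg_app_entourageP => B entB.
  have := ul B entB; rewrite !near_simpl; apply: filterS => n /= /(_ i j).
  by rewrite inE.
apply/cvg_mx_entourageP => B entB.
apply: filter_forall => i; apply: filter_forall => j.
have /cvg_app_entourageP/(_ B entB) := ul i j.
by apply: filterS => n /= Bn; rewrite inE.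
Qed.

Lemma mxentry_form (M : 'M[C]_k) i j :
  M i j = ((delta_mx 0 i : 'rV[C]_k) *m M *m (delta_mx 0 j : 'rV[C]_k)^t*) 0 0.
Proof.
rewrite (_ : _^t* = delta_mx j 0) -?rowE -?colE ?mxE//.
by apply/matrixP => a b; rewrite !mxE conjC_nat andbC.
Qed.

Lemma quad_cvg u l (v : 'rV[C]_k) : (forall i j, (fun n => u n i j) @ \oo --> l i j) ->
  (fun n => (v *m u n *m v^t*) 0 0) @ \oo --> (v *m l *m v^t*) 0 0.
Proof.
move=> ul; have qE M : (v *m M *m v^t*) 0 0 = \sum_i \sum_j v 0 i * M i j * (v 0 j)^*.
  rewrite mxE exchange_big; apply: eq_bigr => j _; rewrite !mxE mulr_suml.
  by apply: eq_bigr => i _.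
rewrite qE; under eq_fun do rewrite qE.
apply: cvg_big => // [|i _]; first exact: add_continuous.
apply: cvg_big => // [|j _]; first exact: add_continuous.
by apply: cvgM; [apply: cvgM; [exact: cvg_cst|exact: ul]|exact: cvg_cst].
Qed.

Lemma psdmx_cvg u l : (forall i j, (fun n => u n i j) @ \oo --> l i j) ->
  (forall n, psdmx (u n)) -> psdmx l.
Proof.
move=> ul pu; split; last first.
  by move=> v; apply: (cvg_CC_ge0 (@quad_cvg _ _ v ul)) => n; case: (pu n).
apply/hermsymmxP/matrixP => i j; rewrite !mxE.
have uji := cvg_conj (ul j i).
have uE : (fun n => (u n j i)^*) = (fun n => u n i j).
  by apply/funext => n; have [/hermsymmxP h _] := pu n; rewrite -[in RHS]h !mxE.
rewrite uE in uji; exact: cvg_unique uji (ul i j).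
Qed.

(** For a fixed row v the numbers v u_n v^* decrease and stay nonnegative, hence converge; every
    entry is a fixed combination of four such numbers. *)
Lemma psdmx_antitone_cvg u : (forall n, psdmx (u n)) ->
  (forall n, loewner_le (u n.+1) (u n)) -> cvgn u.
Proof.
move=> pu udec.
have qcvg (v : 'rV[C]_k) : cvgn (fun n => (v *m u n *m v^t*) 0 0 : C).
  have q0 n : 0 <= (v *m u n *m v^t*) 0 0 by have [_] := pu n; apply.
  apply: (nonincreasing_CC_cvg q0) => n.
  have [_ /(_ v)] := udec n.
  by rewrite mulmxBr mulmxBl !mxE subr_ge0.
have ecvg i j : cvgn (fun n => u n i j).
  pose f n (v w : 'rV[C]_k) : C := (v *m u n *m w^t*) 0 0.
  have f_l n c v w z : f n (c *: v + w) z = c * f n v z + f n w z.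
    by rewrite /f !mulmxDl -!scalemxAl !mxE.
  have f_r n c v w z : f n v (c *: w + z) = c^* * f n v w + f n v z.
    rewrite /f (_ : (c *: w + z)^t* = c^* *: w^t* + z^t*).
      by rewrite mulmxDr -scalemxAr !mxE.
    by apply/matrixP => a b; rewrite !mxE rmorphD rmorphM.
  under eq_fun => n do rewrite mxentry_form -/(f n _ _)
    (ip_polarization (f_l n) (f_r n) (delta_mx 0 j)).
  apply: is_cvgM; first exact: is_cvg_cst.
  apply: is_cvgD; first by apply: is_cvgB; exact: qcvg.
  apply: is_cvgM; first exact: is_cvg_cst.
  by apply: is_cvgB; exact: qcvg.
apply/cvg_ex; exists (\matrix_(i, j) limn (fun n => u n i j)).
by apply/cvg_mx_entryP => i j; rewrite mxE; exact: ecvg.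
Qed.

End LoewnerLimits.

Theorem theorem5p7 (R : realType) (d : nat) (mu : operator R d.+1 -> CC R)
  (mu_measure : nc_measure mu)
  (mu_proba : probability_nc_measure mu)
  (mu_nontrivial : nontrivial_nc_measure mu) :
  forall (k : nat) (A : 'I_d.+1 -> 'M[CC R]_k), (0 < k)%N ->
    cvgn (fun n => christoffel mu n A) /\
    loewner_inf
      [set ncmx_sqform mu Q | Q in [set Q | ncmx_eval A Q = 1%:M]]
      (limn (fun n => christoffel mu n A)).
Proof.
move=> k A _; set u := fun n => christoffel mu n A.
have pu n : psdmx (u n) by exact: christoffel_psd.
have ule n m : (n <= m)%N -> loewner_le (u m) (u n) by exact: christoffel_antitone.
have cu : cvgn u by apply: psdmx_antitone_cvg => // n; exact: ule.
split=> //.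
have ul : forall i j, (fun n => u n i j) @ \oo --> (limn u) i j by exact/cvg_mx_entryP.
set l := limn u in ul *.
split.
- by have [] := psdmx_cvg ul pu.
- move=> _ [Q /= Q1 <-]; have [N QN] := degree_le_exists Q.
  (* [Q] is admissible from degree N on, so the sequence is shifted by N to have the comparison at
     every index. *)
  apply: (@psdmx_cvg _ _ (fun n => ncmx_sqform mu Q - u (n + N)%N)) => [i j|n].
    under eq_fun do rewrite !mxE; rewrite !mxE.
    apply: cvgB; first exact: cvg_cst.
    by rewrite (cvg_shiftn N (fun n => u n i j)).
  apply: christoffel_le_sqform => // i j w /QN; rewrite !mem_words_upto_last.
  by move=> /leq_trans; apply; exact: leq_addl.
(* Every approximate is itself a value of the form at an admissible Q, so [Z] lies below each of
   them and, by closedness of the cone, below their limit. *)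
- move=> Z hZ Zle; apply: (@psdmx_cvg _ _ (fun n => u n - Z)) => [i j|n].
    under eq_fun do rewrite !mxE; rewrite !mxE.
    by apply: cvgB; [exact: ul|exact: cvg_cst].
  have [Q [_ Q1 QE]] := christoffel_attained mu_measure mu_nontrivial A n.
  by rewrite /u -QE; apply: Zle; exists Q.
Qed.
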